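(* Let $\partial$ be a generator on $\mathbf N$, let $\eta$ be a Poisson process on $\mathbb X$ with locally finite intensity measure $\lambda$, and suppose that $\partial\eta$ is a.s. finite or, more generally, that the strong Markov property $$\mathbb P(\eta_{[\eta]}\in\cdot\mid\partial\eta)=\Pi_{\lambda_{[\eta]}}(\cdot)\quad\text{a.s.}$$ holds. Let $f\in L^1(\lambda)\cap L^2(\lambda)$ and $\hat F:=\mathbb E\big[\int f(x)\,\eta(dx)\mid\partial\eta\big]$. Then $\hat F$ is square integrable and $$\operatorname{Var}\hat F=\int f(x)^2\,\mathbb P\big(\partial(\eta+\delta_x)\ne\partial\eta\big)\,\lambda(dx).$$
   Context: $(\mathbb X,\mathcal X)$ is a Borel space with a localising ring $\mathcal X_0\subset\mathcal X$: a ring of sets such that (a) $B\in\mathcal X_0$, $C\in\mathcal X$ imply $B\cap C\in\mathcal X_0$; (b) there is an increasing sequence $B_n\in\mathcal X_0$, $n\in\mathbb N$, with union $\mathbb X$ such that each set in $\mathcal X_0$ has the form $C\cap B_n$ for some $C\in\mathcal X$, $n\in\mathbb N$. A measure is locally finite if it is finite on $\mathcal X_0$. $\mathbf N$ is the set of all measures $\mu$ on $\mathbb X$ with $\mu(B)\in\{0,1,2,\dots\}$ for all $B\in\mathcal X_0$, equipped with the smallest $\sigma$-field making $\mu\mapsto\mu(B)$ measurable for all $B\in\mathcal X$. Write $\operatorname{supp}\mu=\{x:\mu(\{x\})>0\}$; $x\in\mu$ means $x\in\operatorname{supp}\mu$; $\delta_x$ is the Dirac measure at $x$; $\nu_B:=\nu(\cdot\cap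 B)$; $\nu'\le\nu$ means $\nu'(B)\le\nu(B)$ for all $B\in\mathcal X$. A generator is a measurable map $\partial:\mathbf N\to\mathbf N$ such that: (thinning) $\partial\mu\le\mu$ for all $\mu$; (additivity) $\partial(\mu+\delta_x)=\partial\mu+\delta_x$ for all $\mu\in\mathbf N$, $x\in\partial\mu$; (idempotency) $\partial(\partial\mu+\mu')=\partial\mu$ for all $\mu,\mu'\in\mathbf N$ with $\mu'\le\mu-\partial\mu$; (consistency) if $\mu'\le\mu$ and $\partial\mu=\partial\mu'$, then $\partial(\mu+\psi)=\partial(\mu'+\psi)$ for all $\psi\in\mathbf N$. The hull operator is $[\mu]:=\{x\in\mathbb X:\partial(\mu+\delta_x)=\partial\mu\}$. A Poisson process with intensity measure $\lambda$ is a random element $\eta$ of $\mathbf N$ with independent Poisson distributed increments and $\mathbb E\eta(B)=\lambda(B)$; its distribution is denoted $\Pi_\lambda$. *)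

(* Defs.v *)
From HB Require Import structures.
From mathcomp Require Import all_boot all_order all_algebra.
From mathcomp Require Import all_classical all_reals all_analysis.
From mathcomp Require Import measurable_realfun.

Set Implicit Arguments.
Unset Strict Implicit.
Unset Printing Implicit Defensive.

Import Order.TTheory GRing.Theory Num.Theory.
Import numFieldNormedType.Exports.

Local Open Scope classical_set_scope.
Local Open Scope ring_scope.
Local Open Scope ereal_scope.

Definition borel_space (R : realType) d (X : measurableType d) : Prop :=
  exists f : X -> R,
    [/\ injective f, measurable_fun [set: X] f &
        forall A : set X, measurable A -> measurable (f @` A)].

Definition localising_ring d (X : measurableType d) (X0 : set (set X)) : Prop :=
  [/\ setring X0,
      X0 `<=` measurable,
      forall B C, X0 B -> measurable C -> X0 (B `&` C) &
      exists B_ : (set X)^nat,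
        [/\ forall n, X0 (B_ n),
            forall n, B_ n `<=` B_ n.+1,
            \bigcup_n B_ n = [set: X] &
            forall A, X0 A ->
              exists (C : set X) (n : nat), measurable C /\ A = C `&` B_ n]].

Definition locally_finite (R : realType) d (X : measurableType d)
    (X0 : set (set X)) (lam : {measure set X -> \bar R}) : Prop :=
  forall B, X0 B -> lam B < +oo.

(* A library measure is a function on all of [set X], with arbitrary values
   off the sigma-field.  Setting these values to 0 makes Leibniz equality of
   such functions coincide with equality of measures. *)
Definition mtrim (R : realType) d (X : measurableType d)
    (mu : {measure set X -> \bar R}) (B : set X) : \bar R :=
  if `[< measurable B >] then mu B else 0.

Section mtrim_measure.
Context (R : realType) d (X : measurableType d).
Variable mu : {measure set X -> \bar R}.

Lemma mtrimE B : measurable B -> mtrim mu B = mu B.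
Proof. by move=> mB; rewrite /mtrim asboolT. Qed.

Let mtrim0 : mtrim mu set0 = 0.
Proof. by rewrite mtrimE. Qed.

Let mtrim_ge0 B : 0 <= mtrim mu B.
Proof. by rewrite /mtrim; case: ifP. Qed.

Let mtrim_sigma_additive : semi_sigma_additive (mtrim mu).
Proof.
move=> F mF tF mU; rewrite mtrimE//.
under eq_fun do under eq_bigr do rewrite mtrimE//.
exact: measure_semi_sigma_additive.
Qed.

HB.instance Definition _ := isMeasure.Build _ _ _ (mtrim mu)
  mtrim0 mtrim_ge0 mtrim_sigma_additive.

End mtrim_measure.

(* The hull is measurable for every generator on a Borel space, but this is a
   theorem; [mcore] makes restriction to an arbitrary set a total operation,
   which is the usual one on measurable sets. *)
Definition mcore d (X : measurableType d) (D : set X) : set X :=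
  if `[< measurable D >] then D else set0.

Lemma measurable_mcore d (X : measurableType d) (D : set X) :
  measurable (mcore D).
Proof. by rewrite /mcore; case: asboolP. Qed.

Definition restriction (R : realType) d (X : measurableType d)
    (nu : {measure set X -> \bar R}) (D : set X) : {measure set X -> \bar R} :=
  mrestr nu (measurable_mcore D).

Section nmeasure.
Context (R : realType) d (X : measurableType d) (X0 : set (set X)).

Definition integer_on (mu : set X -> \bar R) : Prop :=
  forall B, X0 B -> exists n : nat, mu B = n%:R%:E.

Record nmeasure := NMeasure {
  nmeasure_val :> {measure set X -> \bar R};
  nmeasure_int : integer_on nmeasure_val;
  nmeasure_trim : forall B, ~ measurable B -> nmeasure_val B = 0 }.

Lemma nmeasure_eq (mu nu : nmeasure) :
  (forall B, measurable B -> mu B = nu B) -> mu = nu.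
Proof.
case: mu nu => [mu imu tmu] [nu inu tnu] /= munu.
have /eq_measure E : (mu : set X -> \bar R) = nu.
  apply/funext => B; have [mB|nB] := pselect (measurable B); first exact: munu.
  by rewrite tmu// tnu.
case: _ / E imu tmu inu tnu {munu} => *.
by congr NMeasure; exact: Prop_irrelevance.
Qed.

Lemma mtrim_int (mu : {measure set X -> \bar R}) :
  integer_on mu -> integer_on (mtrim mu).
Proof.
move=> imu B /imu muB; rewrite /mtrim; case: ifP => // _.
by exists 0%N.
Qed.

Lemma mtrim_trim (mu : {measure set X -> \bar R}) B :
  ~ measurable B -> mtrim mu B = 0.
Proof. by move=> nB; rewrite /mtrim asboolF. Qed.

Definition nmeasure_of (mu : {measure set X -> \bar R})
    (imu : integer_on mu) : nmeasure :=
  NMeasure (mtrim_int imu) (@mtrim_trim mu).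

Lemma mzero_int : integer_on (@mzero _ X R).
Proof. by move=> B _; exists 0%N. Qed.

Definition nzero : nmeasure := nmeasure_of mzero_int.

Lemma dirac_int (x : X) : integer_on (dirac x).
Proof. by move=> B _; exists (x \in B : nat); rewrite diracE. Qed.

Definition ndirac (x : X) : nmeasure := nmeasure_of (@dirac_int x).

Lemma add_int (mu nu : nmeasure) : integer_on (measure_add mu nu).
Proof.
move=> B BX0; have [m muB] := nmeasure_int mu BX0.
have [n nuB] := nmeasure_int nu BX0.
by exists (m + n)%N; rewrite measure_addE muB nuB -EFinD natrD.
Qed.

Definition nadd (mu nu : nmeasure) : nmeasure := nmeasure_of (@add_int mu nu).

Lemma ndiracE x B : measurable B -> ndirac x B = \d_x B.
Proof. exact: mtrimE. Qed.

Lemma naddE mu nu B : measurable B -> nadd mu nu B = mu B + nu B.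
Proof. by move=> mB; rewrite -measure_addE; exact: mtrimE. Qed.

Definition nle (mu nu : nmeasure) : Prop :=
  forall B, measurable B -> mu B <= nu B.

Definition nsupp (mu : nmeasure) : set X := [set x | 0 < mu [set x]].

Lemma restriction_int (hX0 : localising_ring X0) (mu : nmeasure) (D : set X) :
  integer_on (restriction mu D).
Proof.
case: hX0 => _ _ X0I _ B BX0.
by have /(nmeasure_int mu) := X0I _ _ BX0 (measurable_mcore D).
Qed.

Definition nrestriction (hX0 : localising_ring X0) (mu : nmeasure)
    (D : set X) : nmeasure :=
  nmeasure_of (@restriction_int hX0 mu D).

Lemma nrestrictionE (hX0 : localising_ring X0) mu D B :
  measurable D -> measurable B -> nrestriction hX0 mu D B = mu (B `&` D).
Proof.
move=> mD mB; rewrite [LHS]mtrimE// /restriction/= /mrestr /mcore.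
by rewrite asboolT.
Qed.

Definition nmeasure_cylinders : set (set nmeasure) :=
  [set A | exists (B : set X) (E : set (\bar R)),
    [/\ measurable B, measurable E & A = [set mu : nmeasure | E (mu B)]]].

HB.instance Definition _ := gen_eqMixin nmeasure.
HB.instance Definition _ := gen_choiceMixin nmeasure.
HB.instance Definition _ := isPointed.Build nmeasure nzero.
HB.instance Definition _ := @isMeasurable.Build
  (sigma_display nmeasure_cylinders) nmeasure
  <<s nmeasure_cylinders >> (@sigma_algebra0 _ setT nmeasure_cylinders)
  (@sigma_algebraC _ nmeasure_cylinders)
  (@sigma_algebra_bigcup _ setT nmeasure_cylinders).

(* In idempotency, [nu] plays the role of the difference [mu - gen mu], which
   is not defined setwise where both measures are infinite. *)
Definition generator (gen : nmeasure -> nmeasure) : Prop :=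
  [/\ measurable_fun [set: nmeasure] gen,
      forall mu, nle (gen mu) mu,
      forall mu x, nsupp (gen mu) x ->
        gen (nadd mu (ndirac x)) = nadd (gen mu) (ndirac x),
      forall mu mu' nu, mu = nadd (gen mu) nu -> nle mu' nu ->
        gen (nadd (gen mu) mu') = gen mu &
      forall mu mu', nle mu' mu -> gen mu = gen mu' ->
        forall psi, gen (nadd mu psi) = gen (nadd mu' psi)].

Definition hull (gen : nmeasure -> nmeasure) (mu : nmeasure) : set X :=
  [set x | gen (nadd mu (ndirac x)) = gen mu].

End nmeasure.

(* The parameter ranges over [0, +oo]; parameter 0 gives the Dirac mass at 0
   (which [poisson_pmf 0] does not) and +oo gives the Dirac mass at +oo. *)
Definition poisson_distributed (R : realType) d (W : measurableType d)
    (P : probability W R) (Y : W -> \bar R) (r : \bar R) : Prop :=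
  if r is a%:E
  then forall n : nat,
    P [set w | Y w = n%:R%:E] = (a ^+ n / n`!%:R * expR (- a))%:E
  else P [set w | Y w = +oo] = 1.

Definition independent_family (R : realType) d (W : measurableType d)
    (P : probability W R) (k : nat) (Y : 'I_k -> W -> \bar R) : Prop :=
  forall E : 'I_k -> set (\bar R), (forall i, measurable (E i)) ->
    P [set w | forall i, E i (Y i w)] = \prod_(i < k) P (Y i @^-1` E i).

Definition poisson_process (R : realType) d (X : measurableType d)
    (X0 : set (set X)) d' (W : measurableType d') (P : probability W R)
    (lam : {measure set X -> \bar R}) (eta : W -> nmeasure R X0) : Prop :=
  [/\ measurable_fun [set: W] eta,
      forall B, measurable B ->
        poisson_distributed P (fun w => eta w B) (lam B) &
      forall (k : nat) (B : 'I_k -> set X),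
        (forall i, measurable (B i)) -> trivIset [set: 'I_k] B ->
        independent_family P (fun i w => eta w (B i))].

(* The law on N under which the identity is a Poisson process with intensity
   [lam].  For locally finite [lam] such a law exists, and any two of them agree
   on measurable sets, so that the default value and the choice made by [xget]
   are immaterial. *)
Definition poisson_law (R : realType) d (X : measurableType d)
    (X0 : set (set X)) (lam : {measure set X -> \bar R}) :
    probability (nmeasure R X0) R :=
  xget point [set Q : probability (nmeasure R X0) R |
    poisson_process Q lam (@id (nmeasure R X0))].

(* [G] is a version of the conditional expectation of [F] given [Z]; as usual
   this is meant for integrable [F]. *)
Definition is_condexp (R : realType) d (W : measurableType d)
    (P : probability W R) d' (T : measurableType d') (Z : W -> T)
    (F G : W -> R) : Prop :=
  [/\ P.-integrable [set: W] (EFin \o G),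
      forall E : set R, measurable E -> g_sigma_algebra_preimage Z (G @^-1` E) &
      forall C, g_sigma_algebra_preimage Z C ->
        \int[P]_(w in C) (G w)%:E = \int[P]_(w in C) (F w)%:E].

Definition strong_markov (R : realType) d (X : measurableType d)
    (X0 : set (set X)) (hX0 : localising_ring X0) d' (W : measurableType d')
    (P : probability W R) (lam : {measure set X -> \bar R})
    (gen : nmeasure R X0 -> nmeasure R X0) (eta : W -> nmeasure R X0) : Prop :=
  forall A : set (nmeasure R X0), measurable A ->
    exists G : W -> R,
      is_condexp P (gen \o eta)
        (fun w => \1_A (nrestriction hX0 (eta w) (hull gen (eta w))))%R G /\
      {ae P, forall w,
        (G w)%:E = poisson_law X0 (restriction lam (hull gen (eta w))) A}.

(* Main.v *)
(* Write H(mu) for the hull of mu.  For every mu and x one has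
   x in H(mu + delta_x) <-> x in H(mu), and in that case mu and mu + delta_x have
   the same generator and the same hull.  The univariate Mecke formula
     E int h(eta, x) eta(dx) = int E h(eta + delta_x, x) lambda(dx)
   can therefore be applied to integrands living on the hull: for g >= 0, with
   S = int_{H(eta)} g d eta and L = int_{H(eta)} g d lambda,
     E[u(gen eta) S] = E[u(gen eta) L],  E S^2 = E L^2 + E int_{H(eta)} g^2 d lambda.
   Since gen eta is the restriction of eta to the complement of H(eta), the first
   identity says that V_g = int g d(gen eta) + L is a version of the conditional
   expectation of int g d eta given gen eta, and the second one yields
     E V_g^2 = (int g d lambda)^2 + int g(x)^2 P(x notin H(eta)) lambda(dx).
   A signed f is reduced to f^+, f^- and |f| = f^+ + f^- by the identity
   (a - b)^2 + (a + b)^2 = 2 a^2 + 2 b^2. *)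
Require Import Defs.
From HB Require Import structures.
From mathcomp Require Import all_boot all_order all_algebra.
From mathcomp Require Import all_classical all_reals all_analysis.
From mathcomp Require Import measurable_realfun.
From mathcomp Require Import ring.

Set Implicit Arguments.
Unset Strict Implicit.
Unset Printing Implicit Defensive.

Import Order.TTheory GRing.Theory Num.Theory.
Import numFieldNormedType.Exports.

Local Open Scope classical_set_scope.
Local Open Scope ring_scope.
Local Open Scope ereal_scope.

(** * Image measures, mixtures and induction on nonnegative functions *)

(** All moment identities for g >= 0 are kept in the extended half-line and in additive form, so
    they need no integrability; a term is cancelled only once it is known to be finite, and this is
    where the integral of g^2 must be finite.

    That gen eta is eta off its hull is not immediate: the axioms on generators test single points,
    while measures are compared on sets. The bridge is atomicity, for which the Borel assumption
    supplies a countable separating family.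

    The Mecke formula is derived from the counts alone. Its two sides are measures on N x X; on
    events described by counts of disjoint sets they reduce to the identity (n+1) p(n+1) = a p(n)
    for Poisson weights, and uniqueness of measures does the rest.

    For signed f the obstacle is the mixed moment of the predictors of f^+ and f^-. It is never
    computed: predictors are additive, so the second moment for |f| already contains it. *)

Section functional_induction.
Context (R : realType) d (T : measurableType d).
Variable Q : (T -> \bar R) -> Prop.
Hypothesis Qindic : forall A, measurable A -> Q (fun x => (\1_A x)%:E).
Hypothesis QD : forall f g, measurable_fun [set: T] f ->
  measurable_fun [set: T] g -> (forall x, 0 <= f x) -> (forall x, 0 <= g x) ->
  Q f -> Q g -> Q (f \+ g).
Hypothesis QZ : forall (r : R) f, (0 <= r)%R -> measurable_fun [set: T] f ->
  (forall x, 0 <= f x) -> Q f -> Q (fun x => r%:E * f x).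
Hypothesis Qlim : forall (f_ : (T -> \bar R)^nat) f,
  (forall n, measurable_fun [set: T] (f_ n)) -> (forall n x, 0 <= f_ n x) ->
  (forall x, nondecreasing_seq (f_ ^~ x)) ->
  (forall n, Q (f_ n)) -> (forall x, f_ n x @[n --> \oo] --> f x) -> Q f.

Import HBNNSimple.

Lemma nneg_measurable_ind f :
  measurable_fun [set: T] f -> (forall x, 0 <= f x) -> Q f.
Proof.
move=> mf f0; pose f_ := nnsfun_approx measurableT mf.
apply: (Qlim (f_ := fun n x => (f_ n x)%:E)).
- by move=> n; exact/measurable_EFinP/measurable_funP.
- by move=> n x; rewrite lee_fin.
- by move=> x m n mn; rewrite lee_fin; exact/lefP/nd_nnsfun_approx.
- move=> n; set h := f_ n.
  have Qsum (s : seq R) : (forall r, r \in s -> (0 <= r)%R) ->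
      Q (fun x => \sum_(r <- s) (r%:E * (\1_(h @^-1` [set r]) x)%:E)).
    elim: s => [|r s IH] s0.
      under eq_fun do rewrite big_nil.
      by have := Qindic measurable0; under eq_fun do rewrite indic0.
    under eq_fun do rewrite big_cons.
    have mhr t : measurable (h @^-1` [set t]) by exact: measurable_funPTI.
    have m1 t : measurable_fun [set: T]
        (fun x => (\1_(h @^-1` [set t]) x)%:E : \bar R).
      exact/measurable_EFinP/measurable_indic.
    apply: QD.
    + exact: measurable_funeM.
    + by apply: emeasurable_sum => t; exact: measurable_funeM.
    + by move=> x; rewrite -EFinM lee_fin mulr_ge0// s0// mem_head.
    + move=> x; rewrite big_seq; apply: sume_ge0 => t ts.
      by rewrite -EFinM lee_fin mulr_ge0// s0// in_cons ts orbT.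
    + by apply: QZ => //; [rewrite s0// mem_head|exact: Qindic].
    + by apply: IH => t ts; rewrite s0// in_cons ts orbT.
  have /finite_seqP[s sE] : finite_set (range h) by exact: fimfunP.
  (* The sum over the range counts each value once, whereas the list [s] may repeat values; hence
     [undup]. *)
  rewrite (_ : (fun x => _) = (fun x => \sum_(r <- undup s)
      (r%:E * (\1_(h @^-1` [set r]) x)%:E))).
    apply: Qsum => r; rewrite mem_undup => rs.
    by have [x _ <-] : range h r by rewrite sE.
  apply/funext => x; rewrite (fimfunE h) sE.
  rewrite (_ : [set` s] = [set` undup s]); last first.
    by apply/seteqP; split => r /=; rewrite mem_undup.
  rewrite -fsbig_seq ?undup_uniq// -sumEFin.
  by apply: eq_bigr => r _; rewrite EFinM.
- by move=> x; exact: cvg_nnsfun_approx.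
Qed.

End functional_induction.

Section image_measure.
Context (R : realType) d1 d2 (T1 : measurableType d1) (T2 : measurableType d2).
Variables (m : {measure set T1 -> \bar R}) (phi : T1 -> T2).
Hypothesis mphi : measurable_fun [set: T1] phi.

Definition image_measure : {measure set T2 -> \bar R} :=
  measure_function_pushforward__canonical__measure_function_Measure m mphi.

Lemma ge0_integral_image (h : T2 -> \bar R) :
  measurable_fun [set: T2] h -> (forall y, 0 <= h y) ->
  \int[image_measure]_y h y = \int[m]_x h (phi x).
Proof.
move=> mh h0; rewrite (ge0_integral_pushforward mphi)// preimage_setT//.
Qed.

End image_measure.

Section mixture.
Context (R : realType) d1 d2 (T1 : measurableType d1) (T2 : measurableType d2).
Variables (m : {measure set T1 -> \bar R}) (k : T1 -> {measure set T2 -> \bar R}).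

Definition measurable_family :=
  forall U, measurable U -> measurable_fun [set: T1] (k ^~ U).

Hypothesis mk : measurable_family.

(** The measurability proof is an argument so that the measure structure, which depends on it, can
    be inferred from the term. *)
Definition mixture of measurable_family :=
  fun U => \int[m]_t k t U.
Local Notation mix := (mixture mk).

Let mixture0 : mix set0 = 0.
Proof. by apply: integral0_eq => t _; rewrite measure0. Qed.

Let mixture_ge0 U : 0 <= mix U.
Proof. exact: integral_ge0. Qed.

Let mixture_sigma_additive : semi_sigma_additive mix.
Proof.
move=> F mF tF mUF.
rewrite (_ : mix _ = \sum_(n <oo) mix (F n)).
  rewrite [X in _ --> X](_ : _ = lim (\sum_(0 <= i < n) mix (F i) @[n --> \oo]))//.
  by apply: is_cvg_nneseries => n _ _; exact: mixture_ge0.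
rewrite /mixture -integral_nneseries//; last by move=> n; exact: mk.
by apply: eq_integral => t _; rewrite measure_semi_bigcup.
Qed.

HB.instance Definition _ := isMeasure.Build _ _ _ mix
  mixture0 mixture_ge0 mixture_sigma_additive.

(** Measurability of the inner integral is carried through the induction, since the formula for a
    sum or a monotone limit uses it for the smaller functions. *)
Lemma ge0_integral_mixture (h : T2 -> \bar R) :
  measurable_fun [set: T2] h -> (forall y, 0 <= h y) ->
  measurable_fun [set: T1] (fun t => \int[k t]_y h y) /\
  \int[mix]_y h y = \int[m]_t \int[k t]_y h y.
Proof.
move: h; apply: nneg_measurable_ind => /=.
- move=> A mA; under [in X in X /\ _]eq_fun do rewrite integral_indic// setIT.
  split; first exact: mk.
  rewrite integral_indic// setIT; apply: eq_integral => t _.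
  by rewrite integral_indic// setIT.
- move=> f g mf mg f0 g0 [mkf kf] [mkg kg].
  have E t : \int[k t]_y (f y + g y) = \int[k t]_y f y + \int[k t]_y g y.
    by rewrite ge0_integralD.
  split; first by under eq_fun do rewrite E; exact: emeasurable_funD.
  have kf0 t : 0 <= \int[k t]_y f y by exact: integral_ge0.
  have kg0 t : 0 <= \int[k t]_y g y by exact: integral_ge0.
  transitivity (\int[m]_t \int[k t]_y f y + \int[m]_t \int[k t]_y g y).
    by rewrite -kf -kg ge0_integralD.
  rewrite -(ge0_integralD m measurableT (fun t _ => kf0 t) mkf
    (fun t _ => kg0 t) mkg).
  by apply: eq_integral => t _; rewrite E.
- move=> r f r0 mf f0 [mkf kf].
  have E t : \int[k t]_y (r%:E * f y) = r%:E * \int[k t]_y f y.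
    by rewrite ge0_integralZl.
  split; first by under eq_fun do rewrite E; exact: measurable_funeM.
  have kf0 t : 0 <= \int[k t]_y f y by exact: integral_ge0.
  transitivity (r%:E * \int[m]_t \int[k t]_y f y).
    by rewrite -kf ge0_integralZl.
  rewrite -(ge0_integralZl m measurableT mkf (fun t _ => kf0 t))//.
  by apply: eq_integral => t _; rewrite E.
- move=> f_ f mf_ f_0 ndf IH cvf.
  have fE : f = fun y => limn (f_ ^~ y).
    by apply/funext => y; apply/esym/cvg_lim => //; exact: cvf.
  have cvk t : \int[k t]_y f_ n y @[n --> \oo] --> \int[k t]_y f y.
    by rewrite fE; apply: cvg_monotone_convergence.
  split.
    apply: (@emeasurable_fun_cvg _ _ _ _ (fun n t => \int[k t]_y f_ n y)).
      by move=> n; case: (IH n).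
    by move=> t _; exact: cvk.
  have /cvg_lim <- // : \int[mix]_y f_ n y @[n --> \oo] --> \int[mix]_y f y.
    by rewrite fE; apply: cvg_monotone_convergence.
  under eq_fun do rewrite (IH _).2.
  rewrite -monotone_convergence//.
  + by apply: eq_integral => t _; apply/cvg_lim => //; exact: cvk.
  + by move=> n; case: (IH n).
  + by move=> n t _; exact: integral_ge0.
  + move=> t _ i j ij; apply: ge0_le_integral => // y _.
    exact: ndf.
Qed.

End mixture.

(** * Locally finite integer-valued measures *)

Section localised.
Context (R : realType) d (X : measurableType d) (X0 : set (set X)).
Hypothesis hX0 : localising_ring X0.
Local Notation N := (nmeasure R X0).
Implicit Types mu nu : N.

Lemma localising_measurable B : X0 B -> measurable B.
Proof. by case: hX0 => _ + _ _ => /[apply]. Qed.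

Lemma localisingI B C : X0 B -> measurable C -> X0 (B `&` C).
Proof. by case: hX0 => _ _ + _; exact. Qed.

Lemma localising_exhaustion : exists B_ : (set X)^nat,
  [/\ forall n, X0 (B_ n), nondecreasing_seq B_ & \bigcup_n B_ n = [set: X]].
Proof.
case: hX0 => _ _ _ [B_ [XB incB cB _]]; exists B_; split => //.
by apply/nondecreasing_seqP => n; apply/subsetPset.
Qed.

Lemma nmeasure_fin_num mu B : X0 B -> mu B \is a fin_num.
Proof. by move=> /(nmeasure_int mu)[n ->]. Qed.

Lemma nmeasure_ge1 mu B : X0 B -> mu B != 0 -> 1 <= mu B.
Proof.
move=> /(nmeasure_int mu)[n ->]; rewrite eqe pnatr_eq0 -lt0n => n0.
by rewrite lee_fin ler1n.
Qed.

Lemma measure_exhaustion (m : {measure set X -> \bar R}) (B_ : (set X)^nat) A :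
  (forall n, measurable (B_ n)) -> nondecreasing_seq B_ ->
  \bigcup_n B_ n = [set: X] -> measurable A ->
  m (A `&` B_ n) @[n --> \oo] --> m A.
Proof.
move=> mB ndB cB mA.
have {2}-> : A = \bigcup_n (A `&` B_ n) by rewrite -setI_bigcupr cB setIT.
apply: (@nondecreasing_cvg_mu _ _ _ m (fun n => A `&` B_ n)).
- by move=> n; exact: measurableI.
- by apply: bigcupT_measurable => n; exact: measurableI.
- by move=> i j ij; apply/subsetPset; apply: setIS; exact/subsetPset/ndB.
Qed.

End localised.

(** * Countable determination and atomicity over a Borel space *)

Section borel.
Context (R : realType) d (X : measurableType d) (X0 : set (set X)).
Hypotheses (hX : borel_space R X) (hX0 : localising_ring X0).
Local Notation N := (nmeasure R X0).
Implicit Types mu nu : N.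

Lemma borel_set1 (x : X) : measurable [set x].
Proof.
case: hX => f [finj mf _].
have := mf measurableT _ (measurable_set1 (f x)); rewrite setTI.
by congr measurable; apply/seteqP; split => [y /finj|y ->].
Qed.

Lemma localising_set1 (x : X) : X0 [set x].
Proof.
have [B_ [XB _ cB]] := localising_exhaustion hX0.
have [n _ Bx] : (\bigcup_n B_ n) x by rewrite cB.
have -> : [set x] = B_ n `&` [set x].
  by apply/seteqP; split => [y ->|y []].
exact/(localisingI hX0)/borel_set1.
Qed.

(** The sets are the [B_ n] cut by preimages under [f] of closed rational rays; [None] means no cut
    and keeps the [B_ n] themselves. The family is stable under intersection and generates the
    sigma-field, and measures in [N] are finite on each [B_ n], so agreement on it suffices. *)
Lemma countable_determining_sets : exists G : nat -> set X,
  [/\ forall n, measurable (G n),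
      forall x y, (forall n, G n x <-> G n y) -> x = y &
      forall mu nu, (forall n, mu (G n) = nu (G n)) -> mu = nu].
Proof.
have [B_ [XB ndB cB]] := localising_exhaustion hX0.
have mB n : measurable (B_ n) by exact/(localising_measurable hX0).
case: hX => f [finj mf fim].
pose ray (q : option rat) : set R :=
  if q is Some r then `]-oo, ratr r]%classic else setT.
have mray q : measurable (ray q).
  by case: q => [q|]; [exact: measurable_itv|exact: measurableT].
pose H (p : nat * option rat) := B_ p.1 `&` f @^-1` ray p.2.
pose G (k : nat) := H (odflt (0%N, None) (unpickle k)).
have mH p : measurable (H p).
  by apply: measurableI => //; rewrite -[X in measurable X]setTI; exact: mf.
have GH p : G (pickle p) = H p by rewrite /G pickleK.
exists G; split.
- by move=> k; exact: mH.
- move=> x y Gxy; apply: finj.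
  wlog xy : x y Gxy / (f x < f y)%R.
    move=> wl; have [xy|xy|//] := ltgtP (f x) (f y); first exact: wl.
    by apply/esym/wl => // n; apply: iff_sym.
  have [q] := rat_in_itvoo xy; rewrite in_itv/= => /andP[/ltW xq qy].
  have [n _ Bx] : (\bigcup_n B_ n) x by rewrite cB.
  have [+ _] := Gxy (pickle (n, Some q)); rewrite GH /H /= !in_itv/= xq.
  by case=> // _ /le_lt_trans/(_ qy); rewrite ltxx.
- move=> mu nu munu; apply: nmeasure_eq => A mA.
  have HE p : mu (H p) = nu (H p) by rewrite -GH.
  have BH n : B_ n = H (n, None) by rewrite /H/= preimage_setT setIT.
  have rH p : range H (H p) by exists p.
  apply: (measure_unique (range H) B_) => //.
  + apply/seteqP; split; last first.
      by apply: smallest_sub; [exact: sigma_algebra_measurable|move=> _ [p _ <-]].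
    pose T := g_sigma_algebraType (range H).
    have mfT : measurable_fun [set: T] (f : T -> R).
      apply: (measurability _ (RGenInftyO.measurableE R)) => _ [_ [r ->] <-].
      (* An open ray is a countable union of closed rational rays, each seen through its traces on
         the [B_ n]; codes that decode to nothing contribute the empty set. *)
      rewrite setTI (_ : _ @^-1` _ = \bigcup_k (if unpickle k is Some (n, q) then
          if (ratr q < r)%R then H (n, Some q) else set0 else set0)).
        apply: bigcupT_measurable => k; case: unpickle => [[n q]|]//.
        by case: ifPn => // _; exact: sub_sigma_algebra.
      apply/seteqP; split => [x /=|x [k _]].
        rewrite in_itv/= => /rat_in_itvoo[q]; rewrite in_itv/= => /andP[/ltW xq qr].
        have [n _ Bx] : (\bigcup_n B_ n) x by rewrite cB.
        by exists (pickle (n, q)); rewrite ?pickleK ?qr//; split; rewrite //= in_itv.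
      case: unpickle => [[n q]|]//; case: ifPn => // qr [_] /=.
      rewrite !in_itv/= => xq; exact: le_lt_trans xq qr.
    (* By injectivity [C] is the preimage of its own image under [f], and that image is Borel. *)
    move=> C mC; have := mfT (@measurableT _ T) _ (fim _ mC); rewrite setTI.
    rewrite [X in measurable X -> _](_ : _ = C) //.
    by apply/seteqP; split => [x [y Cy /finj <-]|x Cx]//; exists x.
  + move=> _ _ [[n p] _ <-] [[m q] _ <-].
    have [k Bk] : exists k, B_ n `&` B_ m = B_ k.
      by case: (leqP n m) => [/ndB|/ltnW/ndB] /subsetPset nm;
        [exists n; rewrite setIidl|exists m; rewrite setIidr].
    have [r rayr] : exists r, ray p `&` ray q = ray r.
      case: p q => [p|] [q|] /=; [|by exists (Some p); rewrite setIT|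
        by exists (Some q); rewrite setTI|by exists None; rewrite setIT].
      exists (Some (Order.min p q)); apply/seteqP; split => x /=; rewrite !in_itv/=.
        by case=> xp xq; rewrite /Order.min; case: ifP.
      have : (ratr (Order.min p q) <= (ratr p : R))%R.
        by rewrite ler_rat ge_min lexx.
      have : (ratr (Order.min p q) <= (ratr q : R))%R.
        by rewrite ler_rat ge_min lexx orbT.
      by move=> mq mp xm; split; exact: le_trans xm _.
    exists (k, r) => //; rewrite /H/= -Bk -rayr preimage_setI.
    by rewrite setIACA.
  + by move=> n; rewrite BH.
  + by move=> _ [p _ <-].
  + by move=> n; rewrite ltey_eq nmeasure_fin_num.
Qed.

(* A finite integer-valued measure that charges [D] charges one of the two
   halves cut out by any set; the nested halves cut out by a separating sequence
   shrink to an atom. *)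
Lemma nmeasure_atomless0 mu D : measurable D ->
  (forall x, D x -> mu [set x] = 0) -> mu D = 0.
Proof.
move=> mD Datom; have [G [mG sepG _]] := countable_determining_sets.
have [B_ [XB ndB cB]] := localising_exhaustion hX0.
have mB n : measurable (B_ n) by exact/(localising_measurable hX0).
suff D0 n : mu (D `&` B_ n) = 0.
  rewrite -(cvg_lim _ (measure_exhaustion mB ndB cB mD))//.
  by under eq_fun do rewrite D0; exact: lim_cst.
have X0D : X0 (D `&` B_ n) by rewrite setIC; exact/(localisingI hX0).
apply/eqP/negPn/negP => D0.
pose next k C := if mu (C `&` G k) != 0 then C `&` G k else C `\` G k.
pose C := fix C k := if k is k'.+1 then next k' (C k') else D `&` B_ n.
have nextS k E : next k E `<=` E by rewrite /next; case: ifP => _ x [].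
have CP k : X0 (C k) /\ mu (C k) != 0.
  elim: k => [//|k [XC C0]]; rewrite /= /next; case: ifPn => [CG|/negPn/eqP CG].
    by split=> //; exact: (localisingI hX0).
  split; first by rewrite setDE; apply/(localisingI hX0)/measurableC.
  apply: contra C0 => /eqP CG'.
  have -> : mu (C k) = mu (C k `\` G k) + mu (C k `&` G k).
    exact/measureDI/mG/(localising_measurable hX0).
  by rewrite CG CG' adde0.
have mC k : measurable (C k) by exact/(localising_measurable hX0)/(CP k).1.
have niC : nonincreasing_seq C.
  by apply/nonincreasing_seqP => k; apply/subsetPset; exact: nextS.
have mI : measurable (\bigcap_k C k).
  by apply: bigcap_measurable => // k _; exact: mC.
have I1 : 1 <= mu (\bigcap_k C k).
  have : mu (C k) @[k --> \oo] --> mu (\bigcap_k C k).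
    apply: nonincreasing_cvg_mu => //.
    by rewrite ltey_eq nmeasure_fin_num.
  move=> muC; rewrite -(cvg_lim _ muC)//; apply: lime_ge.
    by apply/cvg_ex; exists (mu (\bigcap_k C k)).
  by apply: nearW => k; apply: nmeasure_ge1; have [] := CP k.
have [x Ix] : (\bigcap_k C k) !=set0.
  by apply/set0P; apply: contraTneq I1 => ->; rewrite measure0 lee_fin ler10.
have Ix1 : \bigcap_k C k = [set x].
  apply/seteqP; split => [y Iy|y -> //]; apply: sepG => k.
  move: (Ix k.+1 I) (Iy k.+1 I); rewrite /= /next.
  by case: ifPn => _ [_ ?] [_ ?].
move: I1; rewrite Ix1 Datom; first by rewrite lee_fin ler10.
by have [] := Ix 0%N I.
Qed.
End borel.

(** * Subtraction of measures *)

Section measure_difference.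
Context (R : realType) d (X : measurableType d).
Variables (m1 m2 : {measure set X -> \bar R}) (D : set X).
Hypotheses (mD : measurable D) (finD : m1 D < +oo).
Hypothesis (le21 : forall B, measurable B -> m2 B <= m1 B).

(* [mcore] is only there to make the difference nonnegative off the
   sigma-field, as the measure structure demands. *)
Definition mdiff of measurable D & m1 D < +oo &
    (forall B, measurable B -> m2 B <= m1 B) :=
  fun B : set X => m1 (mcore B `&` D) - m2 (mcore B `&` D).
Local Notation mdf := (mdiff mD finD le21).

Lemma mdiffE B : measurable B -> mdf B = m1 (B `&` D) - m2 (B `&` D).
Proof. by move=> mB; rewrite /mdiff /mcore asboolT. Qed.

Let fin1 B : measurable B -> m1 (B `&` D) \is a fin_num.
Proof.
move=> mB; rewrite ge0_fin_numE//; apply: le_lt_trans finD.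
by apply: le_measure; rewrite ?inE//; exact: measurableI.
Qed.

Let fin2 B : measurable B -> m2 (B `&` D) \is a fin_num.
Proof.
move=> mB; rewrite ge0_fin_numE//.
have mBD : measurable (B `&` D) by exact: measurableI.
by rewrite (le_lt_trans (le21 mBD))// ltey_eq fin1.
Qed.

Let mdiff0 : mdf set0 = 0.
Proof. by rewrite mdiffE// set0I !measure0 sube0. Qed.

Let mdiff_ge0 B : 0 <= mdf B.
Proof.
rewrite /mdiff; have mB := @measurable_mcore _ _ B.
rewrite sube_ge0; last by rewrite orbC fin1.
exact/le21/measurableI.
Qed.

Let mdiff_sigma_additive : semi_sigma_additive mdf.
Proof.
move=> F mF tF mUF; rewrite mdiffE//.
have tFD : trivIset setT (fun n => F n `&` D).
  exact: trivIset_setIr.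
have UFD : (\bigcup_n F n) `&` D = \bigcup_n (F n `&` D) by rewrite setI_bigcupl.
have mFD n : measurable (F n `&` D) by exact: measurableI.
rewrite (_ : (fun n => _) = (fun n => \sum_(0 <= i < n) m1 (F i `&` D) -
    \sum_(0 <= i < n) m2 (F i `&` D))); last first.
  apply/funext => n; under eq_bigr do rewrite mdiffE//.
  rewrite big_split/= sumeN// => i j _ _.
  by rewrite fin_num_adde_defl// fin2.
apply: cvgeB.
- by rewrite fin_num_adde_defl// fin_numN fin2.
- rewrite UFD; apply: measure_semi_sigma_additive => //.
  by rewrite -UFD; exact: measurableI.
- rewrite UFD; apply: measure_semi_sigma_additive => //.
  by rewrite -UFD; exact: measurableI.
Qed.

HB.instance Definition _ := isMeasure.Build _ _ _ mdf
  mdiff0 mdiff_ge0 mdiff_sigma_additive.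

Lemma mdiffK B : measurable B -> m2 (B `&` D) + mdf B = m1 (B `&` D).
Proof. by move=> mB; rewrite mdiffE// addeC subeK// fin2. Qed.

End measure_difference.

(** * Order and measurability on the space of integer-valued measures *)

Section nmeasures.
Context (R : realType) d (X : measurableType d) (X0 : set (set X)).
Hypotheses (hX : borel_space R X) (hX0 : localising_ring X0).
Local Notation N := (nmeasure R X0).
Implicit Types (mu nu xi : N) (x : X).

(** Subtraction is meaningless where both measures are infinite. It is performed on the disjoint
    pieces [F n] of the exhaustion, where [mu] is finite, and the differences are summed. *)
Lemma nle_exists mu nu : nle nu mu -> exists xi, mu = nadd nu xi.
Proof.
move=> lenm; have [B_ [XB ndB cB]] := localising_exhaustion hX0.
have mB n : measurable (B_ n) by exact/(localising_measurable hX0).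
pose F := seqDU B_.
have mF n : measurable (F n) by exact: seqDU_measurable.
have finF n : mu (F n) < +oo.
  apply: (@le_lt_trans _ _ (mu (B_ n))).
    by apply: le_measure; rewrite ?inE//; exact: subset_seqDU.
  by rewrite ltey_eq nmeasure_fin_num.
pose m n : {measure set X -> \bar R} := mdiff (mF n) (finF n) lenm.
have muF (mm : {measure set X -> \bar R}) B : measurable B ->
    mm B = \sum_(n <oo) mm (B `&` F n).
  move=> mB'; rewrite -measure_semi_bigcup//.
  - by rewrite -setI_bigcupr -seqDU_bigcup_eq cB setIT.
  - by move=> n; exact: measurableI.
  - exact/trivIset_setIl/trivIset_seqDU.
  - by apply: bigcupT_measurable => n; exact: measurableI.
have mK B : measurable B -> mu B = nu B + mseries m 0 B.
  move=> mB'; rewrite (muF nu)// (muF mu)// /mseries -nneseriesD//.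
  by apply: eq_eseriesr => n _; rewrite mdiffK.
have im : integer_on X0 (mseries m 0).
  move=> B XB'; have := mK _ (localising_measurable hX0 XB').
  have := lenm _ (localising_measurable hX0 XB').
  have [k ->] := nmeasure_int mu XB'; have [l ->] := nmeasure_int nu XB'.
  rewrite lee_fin ler_nat => lk; case: (mseries m 0 B) => [r| |]//= [].
  by move=> E; exists (k - l)%N; rewrite natrB// E addrAC subrr add0r.
exists (nmeasure_of im); apply: nmeasure_eq => B mB'.
by rewrite naddE// [nmeasure_of im B]mtrimE// mK.
Qed.

Lemma measurable_eval B : measurable B ->
  measurable_fun [set: N] (fun mu => mu B).
Proof.
move=> mB _ E mE; rewrite setTI; apply: sub_sigma_algebra.
by exists B, E.
Qed.

Lemma measurable_to_nmeasure d' (T : measurableType d') (phi : T -> N) :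
  (forall B, measurable B -> measurable_fun [set: T] (fun t => phi t B)) ->
  measurable_fun [set: T] phi.
Proof.
move=> mphi; apply: (@measurability _ _ _ _ _ _ (@nmeasure_cylinders R d X X0)) => //.
move=> _ [_ [B [E [mB mE ->]]] <-].
by rewrite setTI -[X in measurable X]setTI; exact: mphi.
Qed.

Lemma measurable_nadd_dirac d' (T : measurableType d') (phi : T -> N) (h : T -> X) :
  measurable_fun [set: T] phi -> measurable_fun [set: T] h ->
  measurable_fun [set: T] (fun t => nadd (phi t) (ndirac R X0 (h t))).
Proof.
move=> mphi mh; apply: measurable_to_nmeasure => B mB.
rewrite (_ : (fun t => _) = (fun t => phi t B + (\1_B (h t))%:E)).
  apply: emeasurable_funD; first exact: measurableT_comp (measurable_eval mB) _.
  by apply/measurable_EFinP/measurableT_comp.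
by apply/funext => t; rewrite naddE// ndiracE// diracE indicE.
Qed.

(** Equality of two measures is a countable conjunction of equalities between extended reals. The
    measurability of the hull rests on this. *)
Lemma measurable_nmeasure_eq d' (T : measurableType d') (phi psi : T -> N) :
  measurable_fun [set: T] phi -> measurable_fun [set: T] psi ->
  measurable [set t | phi t = psi t].
Proof.
move=> mphi mpsi; have [G [mG _ GE]] := countable_determining_sets hX hX0.
rewrite (_ : mkset _ = \bigcap_n [set t | phi t (G n) = psi t (G n)]).
  apply: bigcap_measurable => // n _.
  rewrite -[X in measurable X]setTI; apply: measurable_eqe => //.
  - exact: measurableT_comp (measurable_eval (mG n)) _.
  - exact: measurableT_comp (measurable_eval (mG n)) _.
by apply/seteqP; split => [t /= tt n _ /=|t pp /=];
  [rewrite tt|apply: GE => n; exact: pp].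
Qed.

(** The tautological kernel sending [mu] to itself need not be finite. Restricted to [B_ n] it is
    bounded for each [mu], by a constant depending on [mu], and the restriction is removed by a
    limit in n. *)
Lemma measurable_xsection_nmeasure (U : set (N * X)) : measurable U ->
  measurable_fun [set: N] (fun mu => mu (xsection U mu)).
Proof.
move=> mU; have [B_ [XB ndB cB]] := localising_exhaustion hX0.
have mB n : measurable (B_ n) by exact/(localising_measurable hX0).
pose k : N -> {measure set X -> \bar R} := fun mu => mu.
pose mk := @isKernel.Build _ _ N X R k measurable_eval.
pose k' : R.-ker N ~> X := HB.pack_for (R.-ker N ~> X) k mk.
have mUn n : measurable_fun [set: N] (fun mu => mu (xsection U mu `&` B_ n)).
  have bounded (mu : N) : exists M : R, forall B, measurable B ->
      mrestr (k' mu) (mB n) B < M%:E.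
    have [m muB] := nmeasure_int mu (XB n).
    exists (m.+1%:R) => B mB'; apply: (@le_lt_trans _ _ (mu (B_ n))).
      by apply: le_measure; rewrite ?inE//; exact: measurableI.
    by rewrite muB lte_fin ltr_nat.
  by have [] := measurable_prod_subset_xsection_kernel bounded mU.
have cvgU (mu : N) : [set: N] mu ->
    mu (xsection U mu `&` B_ n) @[n --> \oo] --> mu (xsection U mu).
  by move=> _; apply: measure_exhaustion => //; exact: measurable_xsection.
exact: emeasurable_fun_cvg mUn cvgU.
Qed.

Import HBNNSimple.

Lemma measurable_integral_nmeasure (h : N * X -> \bar R) :
  (forall z, 0 <= h z) -> measurable_fun [set: N * X] h ->
  measurable_fun [set: N] (fun mu => \int[mu]_x h (mu, x)).
Proof.
move=> h0 mh; pose h_ := nnsfun_approx measurableT mh.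
apply: (measurable_fun_xsection_integral h
  (fun mu : N => mu : {measure set X -> \bar R}) h_).
- by move=> a b ab; apply: nd_nnsfun_approx.
- by move=> z; apply: cvg_nnsfun_approx => // t _; exact: h0.
- move=> n r; apply: measurable_xsection_nmeasure.
  exact: measurable_funPTI.
Qed.

End nmeasures.

(** * Generators and hulls *)

Section generators.
Context (R : realType) d (X : measurableType d) (X0 : set (set X)).
Hypotheses (hX : borel_space R X) (hX0 : localising_ring X0).
Local Notation N := (nmeasure R X0).
Variables (gen : N -> N).
Hypothesis hgen : generator gen.
Implicit Types (mu nu xi : N) (x : X).
Local Notation "mu +d x" := (nadd mu (ndirac R X0 x)) (at level 50).

Lemma ndirac_le mu x : 0 < mu [set x] -> nle (ndirac R X0 x) mu.
Proof.
move=> mux B mB; rewrite ndiracE// diracE.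
have [/set_mem Bx|_] := boolP (x \in B); last exact: measure_ge0.
apply: (@le_trans _ _ (mu [set x])).
  apply: (nmeasure_ge1 (localising_set1 hX hX0 x)).
  by rewrite gt_eqF.
apply: le_measure; rewrite ?inE//; first exact: borel_set1 hX x.
by move=> y ->.
Qed.

Lemma localised_nle mu nu : (forall B, X0 B -> mu B <= nu B) -> nle mu nu.
Proof.
move=> lemn B mB; have [B_ [XB ndB cB]] := localising_exhaustion hX0.
have mB_ n : measurable (B_ n) by exact/(localising_measurable hX0).
have cvB (m : N) : m (B `&` B_ n) @[n --> \oo] --> m B.
  exact: measure_exhaustion.
rewrite -(cvg_lim _ (cvB mu))// -(cvg_lim _ (cvB nu))//.
apply: lee_lim; [by apply/cvg_ex; exists (mu B)|by apply/cvg_ex; exists (nu B)|].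
by apply: nearW => n; apply: lemn; rewrite setIC; exact/(localisingI hX0).
Qed.

Lemma nadd_dirac_neq mu x : mu +d x <> mu.
Proof.
move=> /(congr1 (fun nu : N => nu [set x])); have mx := borel_set1 hX x.
rewrite naddE// ndiracE// diracE mem_set//.
have /fineK <- := nmeasure_fin_num mu (localising_set1 hX hX0 x).
rewrite -EFinD => -[] /eqP.
by rewrite -[eqbRHS]addr0 (inj_eq (addrI _)) oner_eq0.
Qed.

Lemma gen_measurable : measurable_fun [set: N] gen.
Proof. by case: hgen. Qed.

Lemma gen_le mu : nle (gen mu) mu.
Proof. by case: hgen => _ + _ _ _; exact. Qed.

(** If [gen mu] had an atom at [x], additivity would make [gen] grow by a unit mass when [x] is
    added, contrary to [x] being in the hull. *)
Lemma gen_hull0 mu x : hull gen mu x -> gen mu [set x] = 0.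
Proof.
case: hgen => _ _ add _ _ hx; apply/eqP/negPn/negP => g0.
apply: (@nadd_dirac_neq (gen mu) x); rewrite -add//.
by rewrite /nsupp/= lt_neqAle eq_sym g0/=.
Qed.

Lemma gen_between mu nu : nle (gen mu) nu -> nle nu mu -> gen nu = gen mu.
Proof.
case: hgen => _ _ _ idem _ /(nle_exists hX0)[xi ->] lemu.
have [xi' muE] := nle_exists hX0 (gen_le mu).
(* The bound [xi <= xi'] comes from cancelling [gen mu], which is legitimate where it is finite; it
   is therefore checked on [X0] only. *)
apply: (idem _ _ _ muE); apply: localised_nle => B XB.
have mB := localising_measurable hX0 XB.
have := lemu B mB; rewrite [in leRHS]muE !naddE// leeD2lE//.
exact: nmeasure_fin_num.
Qed.

Lemma gen_idem mu : gen (gen mu) = gen mu.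
Proof. by apply: gen_between => [B mB|]; [exact: lexx|exact: gen_le]. Qed.

(** Consistency applied to [gen mu <= mu], two measures with the same image under [gen]. It makes
    the hull a function of [gen mu]. *)
Lemma gen_nadd_gen mu xi : gen (nadd (gen mu) xi) = gen (nadd mu xi).
Proof.
case: hgen => _ _ _ _ cons; apply/esym/cons; first exact: gen_le.
by rewrite gen_idem.
Qed.

Lemma hull_gen mu : hull gen (gen mu) = hull gen mu.
Proof. by apply/seteqP; split => x; rewrite /hull/= gen_nadd_gen gen_idem. Qed.

Lemma hull_nadd_dirac mu x : hull gen mu x -> hull gen (mu +d x) = hull gen mu.
Proof. by move=> hx; rewrite -hull_gen hx hull_gen. Qed.

(** For the direction from left to right, [gen (mu +d x)] has no mass at [x], so it already lies
    below [mu]; then [mu] is squeezed between it and [mu +d x], and [gen_between] applies. *)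
Lemma hull_nadd_dirac_self mu x : hull gen (mu +d x) x <-> hull gen mu x.
Proof.
split=> [hx|hx]; last by rewrite hull_nadd_dirac.
apply/esym; apply: gen_between => [B mB|B mB]; last first.
  by rewrite naddE// leeDl.
have mx := borel_set1 hX x.
have mBx : measurable (B `\` [set x]) by exact: measurableD.
have xB0 : gen (mu +d x) (B `&` [set x]) = 0.
  apply/eqP; rewrite eq_le measure_ge0 andbT -(gen_hull0 hx).
  by apply: le_measure; rewrite ?inE//; exact: measurableI.
have -> : gen (mu +d x) B = gen (mu +d x) (B `\` [set x]).
  have -> : gen (mu +d x) B =
    gen (mu +d x) (B `\` [set x]) + gen (mu +d x) (B `&` [set x]).
    exact: measureDI.
  by rewrite xB0 adde0.
apply: le_trans (gen_le _ mBx) _.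
rewrite naddE// ndiracE// diracE memNset ?adde0; last by case=> _; exact.
by apply: le_measure; rewrite ?inE.
Qed.

Lemma hull_measurable mu : measurable (hull gen mu).
Proof.
apply: (measurable_nmeasure_eq hX hX0 (phi := fun x => gen (mu +d x))) => //.
apply: measurableT_comp; first exact: gen_measurable.
exact: measurable_nadd_dirac.
Qed.

Lemma measurable_hull_graph : measurable [set z : N * X | hull gen z.1 z.2].
Proof.
apply: (measurable_nmeasure_eq hX hX0 (phi := fun z : N * X => gen (z.1 +d z.2))).
  apply: measurableT_comp; first exact: gen_measurable.
  exact: measurable_nadd_dirac.
by apply: measurableT_comp; first exact: gen_measurable.
Qed.

(** Write [mu] as [gen mu] plus [xi]. An atom of [xi] lies in the hull, because by idempotency
    adding it to [gen mu] changes nothing, while [gen mu] has no atom in the hull. By atomicity [xi]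
    vanishes off the hull and [gen mu] on it. *)
Lemma genE mu B : measurable B -> gen mu B = mu (B `\` hull gen mu).
Proof.
move=> mB; have mH := hull_measurable mu.
have [xi muE] := nle_exists hX0 (gen_le mu).
have xiH : xi (B `\` hull gen mu) = 0.
  apply: (nmeasure_atomless0 hX hX0); first exact: measurableD.
  move=> x [_ nhx]; apply/eqP/negPn/negP => xi0; apply: nhx.
  rewrite /hull/= -gen_nadd_gen; case: hgen => _ _ _ idem _.
  apply: (idem _ _ _ muE); apply: ndirac_le.
  by rewrite lt_neqAle eq_sym xi0/=.
have genH : gen mu (B `&` hull gen mu) = 0.
  apply: (nmeasure_atomless0 hX hX0); first exact: measurableI.
  by move=> x [_ /gen_hull0].
have -> : gen mu B =
  gen mu (B `\` hull gen mu) + gen mu (B `&` hull gen mu) by exact: measureDI.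
rewrite genH adde0 {3}muE naddE ?xiH ?adde0//; exact: measurableD.
Qed.

End generators.

(** * The Mecke formula *)

Section finite_partition_atoms.
Context d (X : measurableType d) (J : finType) (C : J -> set X).
Hypothesis mC : forall j, measurable (C j).

(** The atoms, possibly empty, of the finite algebra generated by the [C j]. Independence of counts
    is given for disjoint sets, so overlapping families are refined to atoms. *)
Definition atom (s : {ffun J -> bool}) : set X :=
  \bigcap_j (if s j then C j else ~` C j).

Lemma atom_measurable s : measurable (atom s).
Proof.
apply: fin_bigcap_measurable => [|j _]; first exact: finite_finset.
by case: (s j) => //; exact: measurableC.
Qed.

Lemma atom_trivIset : trivIset [set: {ffun J -> bool}] atom.
Proof.
move=> s t _ _ [x [sx tx]]; apply/ffunP => j.
by move: (sx j I) (tx j I); case: (s j) (t j) => [] [].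
Qed.

Lemma atom_cover (A : set X) : (forall s, atom s `<=` A \/ atom s `&` A = set0) ->
  A = \bigcup_(s in [set s | atom s `<=` A]) atom s.
Proof.
move=> atA; apply/seteqP; split => [x Ax|x [s sA /sA]]//.
have xs : atom [ffun j => x \in C j] x.
  by move=> j _; rewrite ffunE; case: ifPn => [/set_mem|/negP nCx Cx]//;
    apply: nCx; exact/mem_set.
exists [ffun j => x \in C j] => //=.
have [//|/seteqP[+ _]] := atA [ffun j => x \in C j].
by move=> /(_ x (conj xs Ax)).
Qed.

Lemma atom_refines j s : atom s `<=` C j \/ atom s `&` C j = set0.
Proof.
case sj : (s j); [left=> x /(_ j I)|right]; first by rewrite sj.
by apply/seteqP; split => // x [/(_ j I)]; rewrite sj.
Qed.

End finite_partition_atoms.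

Section nat_valued.
Context (R : realType) d (W : measurableType d) (P : {measure set W -> \bar R}).

Lemma integral_nat_valued (Y : W -> \bar R) (h : \bar R -> \bar R) A :
  measurable_fun [set: W] Y -> (forall w, exists n : nat, Y w = n%:R%:E) ->
  measurable_fun [set: W] (h \o Y) -> (forall w, 0 <= h (Y w)) -> measurable A ->
  \int[P]_(w in A) h (Y w) =
  \sum_(n <oo) h n%:R%:E * P (A `&` [set w | Y w = n%:R%:E]).
Proof.
move=> mY natY mhY h0 mA.
have mYn n : measurable [set w | Y w = n%:R%:E].
  by rewrite -[X in measurable X]setTI; exact: (mY measurableT [set n%:R%:E]).
have AE : A = \bigcup_(n : nat) (A `&` [set w | Y w = n%:R%:E]).
  rewrite -setI_bigcupr (_ : \bigcup_n _ = setT) ?setIT//.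
  by apply/seteqP; split => // w _; have [n Yn] := natY w; exists n.
rewrite [in LHS]AE ge0_integral_bigcup//.
- apply: eq_eseriesr => n _.
  rewrite (eq_integral (cst (h n%:R%:E))); last by move=> w /set_mem[_ /= ->].
  by rewrite integral_cst//; exact: measurableI.
- by move=> n; exact: measurableI.
- exact: measurable_funTS.
- apply: trivIset_setIl => m n _ _ [w /= [-> [] /eqP]].
  by rewrite eqr_nat => /eqP.
Qed.

End nat_valued.

Section poisson.
Context (R : realType) d (X : measurableType d) (X0 : set (set X)).
Hypothesis hX0 : localising_ring X0.
Local Notation N := (nmeasure R X0).
Variables (lam : {measure set X -> \bar R}).
Hypothesis hlam : locally_finite X0 lam.
Context d' (W : measurableType d') (P : probability W R) (eta : W -> N).
Hypothesis heta : poisson_process P lam eta.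

Lemma poisson_measurable : measurable_fun [set: W] eta.
Proof. by case: heta. Qed.

Lemma poisson_measurable_eval B : measurable B ->
  measurable_fun [set: W] (fun w => eta w B).
Proof.
move=> mB; exact: measurableT_comp (measurable_eval mB) poisson_measurable.
Qed.

Lemma poisson_independent (I : finType) (D : I -> set X) (E : I -> set (\bar R)) :
  (forall i, measurable (D i)) -> trivIset [set: I] D ->
  (forall i, measurable (E i)) ->
  P [set w | forall i, E i (eta w (D i))] =
  \prod_(i : I) P [set w | E i (eta w (D i))].
Proof.
move=> mD tD mE; case: heta => _ _ ind.
have := ind #|I| (D \o enum_val) (fun i => mD _) _ (E \o enum_val) (fun i => mE _).
rewrite (_ : [set w | _] = [set w | forall i, E i (eta w (D i))]); last first.
  apply/seteqP; split => w /= Ew i //.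
  by have := Ew (enum_rank i); rewrite enum_rankK.
move=> ->.
  rewrite [RHS](reindex _ (onW_bij _ (enum_val_bij I)))/=.
  by apply: eq_bigr.
by move=> i j _ _ /= [x Dx]; apply/enum_val_inj/tD => //; exists x.
Qed.

(** Size-biasing a Poisson law shifts it by one: this is the Mecke formula for a single count. *)
Lemma poisson_pmf_shift B (n : nat) : X0 B ->
  n.+1%:R%:E * P [set w | eta w B = n.+1%:R%:E] =
  lam B * P [set w | eta w B = n%:R%:E].
Proof.
move=> XB; case: heta => _ /(_ B (localising_measurable hX0 XB)) + _.
rewrite /poisson_distributed; have := hlam XB; have : 0 <= lam B by [].
case: (lam B) => [a| |]// _ _ /= pmf.
rewrite !pmf -!EFinM; congr EFin.
rewrite factS natrM invfM exprS.
have n0 : (n.+1%:R != 0 :> R)%R by rewrite pnatr_eq0.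
have n1 : (n`!%:R != 0 :> R)%R by rewrite pnatr_eq0 -lt0n fact_gt0.
by field; rewrite n1 nat1r n0.
Qed.

End poisson.

(** * Equality of the two Mecke measures *)

Section mecke.
Context (R : realType) d (X : measurableType d) (X0 : set (set X)).
Hypotheses (hX : borel_space R X) (hX0 : localising_ring X0).
Local Notation N := (nmeasure R X0).
Variables (lam : {measure set X -> \bar R}).
Hypothesis hlam : locally_finite X0 lam.
Context d' (W : measurableType d') (P : probability W R) (eta : W -> N).
Hypothesis heta : poisson_process P lam eta.
Local Notation "mu +d x" := (nadd mu (ndirac R X0 x)) (at level 50).

Let meta := poisson_measurable heta.

Lemma measurable_rect (I : finType) (D : I -> set X) (E : I -> set (\bar R)) :
  (forall i, measurable (D i)) -> (forall i, measurable (E i)) ->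
  measurable [set mu : N | forall i, E i (mu (D i))].
Proof.
move=> mD mE.
rewrite (_ : mkset _ = \bigcap_i [set mu : N | E i (mu (D i))]); last first.
  by apply/seteqP; split => [mu Emu i _|mu Emu i]; exact: Emu.
apply: fin_bigcap_measurable => [|i _]; first exact: finite_finset.
by rewrite -[X in measurable X]setTI; exact: (measurable_eval (mD i)).
Qed.

(** A point added in [D j] moves only the count of [D j]. The constraints on the other sets factor
    out as [K] by independence, and what remains is the shift identity summed over the values of
    that count. *)
Lemma mecke_disjoint (I : finType) (D : I -> set X) (E : I -> set (\bar R)) (j : I) :
  (forall i, measurable (D i)) -> trivIset [set: I] D ->
  (forall i, measurable (E i)) -> X0 (D j) ->
  \int[P]_(w in [set w | forall i, E i (eta w (D i))]) eta w (D j) =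
  lam (D j) * P [set w | forall i, E i (eta w (D i) + (i == j)%:R%:E)].
Proof.
move=> mD tD mE XD.
pose K := \prod_(i | i != j) P [set w | E i (eta w (D i))].
have PK (F : set (\bar R)) : measurable F ->
    P [set w | forall i, (if i == j then F else E i) (eta w (D i))] =
    P [set w | F (eta w (D j))] * K.
  move=> mF; rewrite (poisson_independent heta
    (E := fun i => if i == j then F else E i) mD tD).
    rewrite (bigD1 j)//= eqxx; congr (_ * _).
    by apply: eq_bigr => i /negbTE ->.
  by move=> i; case: ifP.
have natD w : exists n : nat, eta w (D j) = n%:R%:E.
  exact: (nmeasure_int (eta w)).
have mYj := poisson_measurable_eval heta (mD j).
have mS (F : set (\bar R)) : measurable F -> measurable [set w | F (eta w (D j))].
  by move=> mF; rewrite -[X in measurable X]setTI; exact: mYj.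
pose F : set (\bar R) := [set y | E j (y + 1)].
have mF : measurable F.
  rewrite -[F]setTI; apply: (emeasurable_funD _ _ measurableT (mE j)) => //.
have mYn n : measurable [set w | eta w (D j) = n%:R%:E].
  exact: (mS [set n%:R%:E]).
have -> : P [set w | forall i, E i (eta w (D i) + (i == j)%:R%:E)] =
    (\sum_(n <oo) P ([set w | F (eta w (D j))] `&`
                     [set w | eta w (D j) = n%:R%:E])) * K.
  rewrite (_ : mkset _ =
      [set w | forall i, (if i == j then F else E i) (eta w (D i))]).
    rewrite PK//; congr (_ * _).
    have := @integral_nat_valued _ _ _ P _ (cst 1) _ mYj natD _ _ (mS _ mF).
    rewrite integral_cst ?mul1e; last exact: mS.
    move=> ->//; last exact: measurable_cst.
    by apply: eq_eseriesr => n _; rewrite mul1e.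
  apply/seteqP; split => w /= Ew i; have := Ew i; case: eqP => [->|_]//=;
    by rewrite adde0.
rewrite (@integral_nat_valued _ _ _ P _ id)//=; last first.
  rewrite -[X in measurable X]/(eta @^-1` [set mu : N | forall i, E i (mu (D i))]).
  rewrite -[X in measurable X]setTI; apply: meta => //; exact: measurable_rect.
have LE n : P ([set w | forall i, E i (eta w (D i))] `&`
    [set w | eta w (D j) = n%:R%:E]) =
    P [set w | E j (eta w (D j)) /\ eta w (D j) = n%:R%:E] * K.
  rewrite -(PK (E j `&` [set n%:R%:E])); last exact: measurableI.
  congr (P _); apply/seteqP; split => [w /= [Ew Yn] i|w Ew].
    by case: eqP => [->|_]; [split => //; exact: Ew|exact: Ew].
  have /= := Ew j; rewrite eqxx => -[_ Yn]; split => // i.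
  by have := Ew i; case: eqP => [->[]|].
have K0 : 0 <= K by apply: prode_ge0.
have sumK (f : nat -> \bar R) : (forall n, 0 <= f n) ->
    \sum_(n <oo) (f n * K) = (\sum_(n <oo) f n) * K.
  move=> f0; have Kfin : K \is a fin_num.
    apply: prode_fin_num => i _; apply: fin_num_measure.
    rewrite -[X in measurable X]setTI.
    exact: (poisson_measurable_eval heta (mD i)).
  rewrite muleC -(fineK Kfin) -nneseriesZl//.
  by apply: eq_eseriesr => n _; rewrite muleC.
under eq_eseriesr do rewrite LE muleA.
rewrite sumK; last by move=> n; rewrite mule_ge0// lee_fin.
rewrite muleA; congr (_ * K).
have lamfin : lam (D j) \is a fin_num.
  by rewrite ge0_fin_numE//; exact: hlam.
rewrite -(fineK lamfin) -nneseriesZl// fineK//.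
(* The value 0 contributes nothing on the left, so the term for n+1 there is matched with the term
   for n on the right. *)
rewrite nneseries_recl//; last by move=> n _; rewrite mule_ge0// lee_fin.
rewrite mul0e add0e -(nneseries_addn 1); last first.
  by move=> n; rewrite mule_ge0// lee_fin.
apply: eq_eseriesr => n _; rewrite addn1.
have [EjS|nEjS] := pselect (E j n.+1%:R%:E).
  rewrite (_ : mkset _ = [set w | eta w (D j) = n.+1%:R%:E]); last first.
    by apply/seteqP; split => w /=; [case|move=> ->].
  rewrite (_ : _ `&` _ = [set w | eta w (D j) = n%:R%:E]).
    exact: poisson_pmf_shift heta _ _ XD.
  apply/seteqP; split => w /=; first by case.
  by move=> Yn; split => //; rewrite /F/= Yn -EFinD natr1.
rewrite (_ : mkset _ = set0) ?measure0 ?mule0; last first.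
  by apply/seteqP; split => w //= [+ Yn]; rewrite Yn.
rewrite (_ : _ `&` _ = set0) ?measure0 ?mule0//.
by apply/seteqP; split => w //= [+ Yn]; rewrite /F/= Yn -EFinD natr1.
Qed.

Let mk1w (w : W) : measurable_fun [set: X] (fun x : X => (eta w, x)).
Proof. exact: pair1_measurable. Qed.

Let k1 (w : W) : {measure set (N * X) -> \bar R} := image_measure (eta w) (mk1w w).

Let mk1 : measurable_family k1.
Proof.
move=> U mU; rewrite (_ : (fun w => _) = (fun w => eta w (xsection U (eta w)))).
  exact: measurableT_comp (measurable_xsection_nmeasure hX0 mU) meta.
by apply/funext => w; rewrite xsectionE.
Qed.

Let madd : measurable_fun [set: W * X] (fun z : W * X => (eta z.1 +d z.2, z.2)).
Proof.
apply/measurable_fun_pair => //.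
apply: measurable_nadd_dirac => //.
by apply: measurableT_comp.
Qed.

Let mk2x (x : X) : measurable_fun [set: W] (fun w => (eta w +d x, x)).
Proof. exact: (measurable_fun_pair1 x madd). Qed.

Let k2 (x : X) : {measure set (N * X) -> \bar R} := image_measure P (mk2x x).

Let mk2 : measurable_family k2.
Proof.
move=> U mU.
have mU' : measurable ((fun z : W * X => (eta z.1 +d z.2, z.2)) @^-1` U).
  by rewrite -[X in measurable X]setTI; exact: madd.
have := measurable_fun_ysection P mU'.
by congr measurable_fun; apply/funext => x; rewrite /= ysectionE.
Qed.

(** [M1] is the Campbell measure, U being sent to E int 1_U(eta, x) eta(dx), and [M2] sends U to int
    P((eta + delta_x, x) in U) lambda(dx). The Mecke formula says that they coincide. *)
Let M1 : {measure set (N * X) -> \bar R} := mixture P mk1.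
Let M2 : {measure set (N * X) -> \bar R} := mixture lam mk2.

Let M1X A B : measurable A -> measurable B ->
  M1 (A `*` B) = \int[P]_(w in eta @^-1` A) eta w B.
Proof.
move=> mA mB; rewrite [RHS]integral_mkcond; apply: eq_integral => w _.
rewrite patchE /k1/= /pushforward; case: ifPn => [/set_mem Aw|/negP nAw].
  by congr (eta w _); apply/seteqP; split => [x []//|x Bx]; split.
rewrite (_ : _ @^-1` _ = set0) ?measure0//.
by apply/seteqP; split => // x [Aw _]; apply: nAw; exact/mem_set.
Qed.

Let M2X A B : measurable A -> measurable B ->
  M2 (A `*` B) = \int[lam]_(x in B) P [set w | A (eta w +d x)].
Proof.
move=> mA mB; rewrite [RHS]integral_mkcond; apply: eq_integral => x _.
rewrite patchE /k2/= /pushforward; case: ifPn => [/set_mem Bx|/negP nBx].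
  by congr (P _); apply/seteqP; split => [w []//|w Aw]; split.
rewrite (_ : _ @^-1` _ = set0) ?measure0//.
by apply/seteqP; split => // w [_ Bx]; apply: nBx; exact/mem_set.
Qed.

(** Freezing [B] gives a measure on [N] alone, to which uniqueness theorems apply; for [M1] and [B]
    in [X0] it is finite. *)
Let slice (M : {measure set (N * X) -> \bar R}) B (mB : measurable B) :
    {measure set N -> \bar R} :=
  image_measure (mrestr M (measurableX (@measurableT _ N) mB))
    (@measurable_fst _ _ N X).

Let sliceE M B (mB : measurable B) A : slice M mB A = M (A `*` B).
Proof.
rewrite /slice/= /pushforward /mrestr; congr (M _).
by apply/seteqP; split => [z [? []]|z [? ?]]; split.
Qed.

Let M1_fin B : X0 B -> M1 (setT `*` B) < +oo.
Proof.
move=> XB; have mB := localising_measurable hX0 XB.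
rewrite M1X// preimage_setT.
have := @mecke_disjoint unit (fun=> B) (fun=> setT) tt (fun=> mB) _
  (fun=> measurableT) XB.
rewrite (_ : mkset _ = setT) => [->|]; last by apply/seteqP; split.
  by rewrite probability_setT mule1; exact: hlam.
by move=> [] [].
Qed.

Let M12_atom (I : finType) (D : I -> set X) (E : I -> set (\bar R)) (j : I) :
  (forall i, measurable (D i)) -> trivIset [set: I] D ->
  (forall i, measurable (E i)) -> X0 (D j) ->
  M1 ([set mu : N | forall i, E i (mu (D i))] `*` D j) =
  M2 ([set mu : N | forall i, E i (mu (D i))] `*` D j).
Proof.
move=> mD tD mE XD; have mA := measurable_rect mD mE.
rewrite M1X// M2X// mecke_disjoint//.
(* For [x] in [D j] the probability does not depend on [x]: by disjointness exactly the [j]-th count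
   goes up by one. *)
rewrite muleC -integral_cst//; apply: eq_integral => x /set_mem Dx.
have nE (w : W) i : (eta w +d x) (D i) = eta w (D i) + (i == j)%:R%:E.
  rewrite naddE// ndiracE// diracE; congr (_ + _%:R%:E); congr nat_of_bool.
  apply/idP/eqP => [/set_mem Dix|->]; last exact/mem_set.
  by apply: tD => //; exists x.
congr (P _); apply/seteqP; split => w Ew i; first by rewrite nE; exact: Ew.
by have := Ew i; rewrite nE.
Qed.

(** On each atom contained in [B], the two slices agree on events given by atom counts; these events
    are stable under intersection, and the cylinder belongs to the sigma-field that they
    generate. *)
Let M12_cylinder (J : finType) (C : J -> set X) (E : J -> set (\bar R)) B :
  (forall j, measurable (C j)) -> (forall j, measurable (E j)) -> X0 B ->
  M1 ([set mu : N | forall j, E j (mu (C j))] `*` B) =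
  M2 ([set mu : N | forall j, E j (mu (C j))] `*` B).
Proof.
move=> mC mE XB; have mB := localising_measurable hX0 XB.
(* Including [B] as the extra index [None] makes it a union of atoms. *)
pose C' (o : option J) := if o is Some j then C j else B.
have mC' o : measurable (C' o) by case: o.
pose D := atom C'.
have mD s : measurable (D s) by exact: atom_measurable.
have tD : trivIset [set: {ffun option J -> bool}] D by exact: atom_trivIset.
set A := [set mu : N | _].
have mA : measurable A by exact: measurable_rect.
suff AD s : D s `<=` B -> M1 (A `*` D s) = M2 (A `*` D s).
  have Bat := atom_cover (A := B) (atom_refines C' None).
  have ABE : A `*` B = \bigcup_(s in [set s | D s `<=` B]) (A `*` D s).
    by rewrite -setX_bigcupr; congr (_ `*` _).
  have fin : finite_set [set s | D s `<=` B] by exact: finite_finset.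
  have tAD : trivIset [set s | D s `<=` B] (fun s => A `*` D s).
    by move=> s t sB tB [z [[_ zs] [_ zt]]]; apply: tD => //; exists z.2.
  rewrite ABE !measure_fin_bigcup//; last 2 first.
  - by move=> s _; exact: measurableX.
  - by move=> s _; exact: measurableX.
  by apply: eq_fsbigr => s /set_mem; exact: AD.
move=> sB.
have XD : X0 (D s) by rewrite -(setIidr sB); exact: (localisingI hX0).
pose G := [set [set mu : N | forall t, F t (mu (D t))] |
  F in [set F : {ffun option J -> bool} -> set (\bar R) |
        forall t, measurable (F t)]].
have Gm : G `<=` measurable by move=> _ [F mF <-]; exact: measurable_rect.
rewrite -!(sliceE _ (mD s)).
apply: (g_sigma_algebra_measure_unique G Gm (fun=> setT)) => //.
- move=> _; exists (fun=> setT) => //=.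
  by apply/seteqP; split.
- by rewrite bigcup_const//; exists 0%N.
- move=> _ _ [F mF <-] [F' mF' <-]; exists (fun t => F t `&` F' t).
    by move=> t; exact: measurableI.
  apply/seteqP; split => [mu H|mu [H H'] t]; last by split; [exact: H|exact: H'].
  by split => t; have [] := H t.
- by move=> _ [F mF <-]; rewrite !sliceE; exact: M12_atom.
- by move=> _; rewrite sliceE; exact: M1_fin.
- pose T := g_sigma_algebraType G.
  have mDt t : measurable_fun [set: T] (fun mu : T => (mu : N) (D t)).
    move=> _ F mF; rewrite setTI; apply: sub_sigma_algebra.
    exists (fun t' => if t' == t then F else setT).
      by move=> t'; case: ifP.
    apply/seteqP; split => [mu /(_ t)|mu Fmu t'] /=; first by rewrite eqxx.
    by case: eqP => // ->.
  (* Each [C j] is a disjoint union of atoms, so its count is a finite sum of atom counts. *)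
  have mCj j : measurable_fun [set: T] (fun mu : T => (mu : N) (C j)).
    rewrite (_ : (fun mu => _) =
        (fun mu : T => \sum_(t \in [set t | D t `<=` C j]) (mu : N) (D t))).
      by apply: emeasurable_fsum => //; exact: finite_finset.
    apply/funext => mu.
    rewrite {1}(atom_cover (A := C j) (atom_refines C' (Some j))).
    rewrite measure_fin_bigcup//; first exact: finite_finset.
    exact: sub_trivIset tD.
  have : measurable [set mu : T | forall j, E j ((mu : N) (C j))].
    rewrite (_ : mkset _ = \bigcap_j [set mu : T | E j ((mu : N) (C j))]).
      apply: fin_bigcap_measurable => [|j _]; first exact: finite_finset.
      by rewrite -[X in measurable X]setTI; exact: (mCj j).
    by apply/seteqP; split => [mu Emu j _|mu Emu j]; exact: Emu.
  by [].
Qed.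

Let M12X A B : measurable A -> X0 B -> M1 (A `*` B) = M2 (A `*` B).
Proof.
move=> mA XB; have mB := localising_measurable hX0 XB.
rewrite -!(sliceE _ mB).
pose G : set (set N) := [set A | exists (J : finType) (C : J -> set X)
  (E : J -> set (\bar R)), [/\ forall j, measurable (C j),
    forall j, measurable (E j) & A = [set mu : N | forall j, E j (mu (C j))]]].
have GT : G setT.
  exists 'I_0, (fun=> set0), (fun=> setT); split => //.
  by apply/seteqP; split.
apply: (measure_unique G (fun=> setT)) => //.
- apply/seteqP; split.
    apply: smallest_sub; first exact: smallest_sigma_algebra.
    move=> _ [C [E [mC mE ->]]]; apply: sub_sigma_algebra.
    exists unit, (fun=> C), (fun=> E); split => //.
    by apply/seteqP; split => [mu Emu []//|mu]; exact.
  apply: smallest_sub; first exact: sigma_algebra_measurable.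
  by move=> _ [J [C [E [mC mE ->]]]]; exact: measurable_rect.
- move=> _ _ [J [C [E [mC mE ->]]]] [J' [C' [E' [mC' mE' ->]]]].
  exists (J + J')%type, (fun j => match j with inl j => C j | inr j => C' j end),
    (fun j => match j with inl j => E j | inr j => E' j end).
  split; [by case|by case|].
  apply/seteqP; split => [mu [H H'] [j|j]|mu H]; [exact: H|exact: H'|].
  by split => j; [exact: (H (inl j))|exact: (H (inr j))].
- by rewrite bigcup_const//; exists 0%N.
- by move=> _ [J [C [E [mC mE ->]]]]; rewrite !sliceE; exact: M12_cylinder.
- by move=> _; rewrite sliceE; exact: M1_fin.
Qed.

Let M12 U : measurable U -> M1 U = M2 U.
Proof.
move=> mU; have [B_ [XB ndB cB]] := localising_exhaustion hX0.
have mB n : measurable (B_ n) by exact/(localising_measurable hX0).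
(* Sides [B] are taken in [X0], where the rectangles have already been treated; a general measurable
   side is the countable union of its traces on the [B_ n]. *)
pose G := [set A `*` B | A in @measurable _ N & B in X0].
apply: (measure_unique G (fun n => setT `*` B_ n)) => //.
- rewrite measurable_prod_measurableType; apply/seteqP; split; last first.
    apply: smallest_sub; first exact: smallest_sigma_algebra.
    move=> _ [A mA [B XB' <-]]; apply: sub_sigma_algebra.
    by exists A => //; exists B => //; exact: (localising_measurable hX0).
  apply: smallest_sub; first exact: smallest_sigma_algebra.
  move=> _ [A mA [B mB' <-]].
  rewrite (_ : A `*` B = \bigcup_n (A `*` (B_ n `&` B))).
    apply: (@bigcupT_measurable _ (g_sigma_algebraType G)) => n.
    apply: sub_sigma_algebra; exists A => //; exists (B_ n `&` B) => //.
    exact: (localisingI hX0).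
  by rewrite -setX_bigcupr -setI_bigcupl cB setTI.
- move=> _ _ [A mA [B XB' <-]] [A' mA' [B' XB'' <-]].
  exists (A `&` A'); first exact: measurableI.
  exists (B `&` B'); last by rewrite setXI.
  exact/(localisingI hX0)/(localising_measurable hX0).
- by move=> n; exists setT => //; exists (B_ n).
- by rewrite -setX_bigcupr cB setXTT.
- by move=> _ [A mA [B XB' <-]]; exact: M12X.
- by move=> n; exact: M1_fin.
Qed.

Theorem mecke (h : N * X -> \bar R) :
  measurable_fun [set: N * X] h -> (forall z, 0 <= h z) ->
  \int[P]_w \int[eta w]_x h (eta w, x) =
  \int[lam]_x \int[P]_w h (eta w +d x, x).
Proof.
move=> mh h0.
transitivity (\int[M1]_z h z).
  have [_ ->//] := ge0_integral_mixture P mk1 mh h0.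
  by apply: eq_integral => w _; rewrite /k1 ge0_integral_image.
transitivity (\int[M2]_z h z).
  by apply: eq_measure_integral => U mU _; exact: M12.
have [_ ->//] := ge0_integral_mixture lam mk2 mh h0.
by apply: eq_integral => w _; rewrite /k2 ge0_integral_image.
Qed.

End mecke.

(** * Moments on the hull *)

Section sigma_finite_tonelli.
Context (R : realType) d1 d2 (T1 : measurableType d1) (T2 : measurableType d2).
Variables (P : probability T1 R) (m : {measure set T2 -> \bar R}).
Hypothesis sfm : sigma_finite [set: T2] m.

(** [m] is repackaged with the sigma-finite structure that Tonelli's theorem expects; [mE]
    identifies the two. *)
Let m_sfinite := isSFinite.Build _ _ _ (Measure.sort m)
  (sfinite_measure_sigma_finite sfm).
Let m_sigma_finite := isSigmaFinite.Build _ _ _ (Measure.sort m) sfm.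
Let m' := HB.pack_for (SigmaFiniteMeasure.type T2 R) (Measure.sort m)
  m_sfinite m_sigma_finite.
Let mE : m = m' :> {measure set T2 -> \bar R}.
Proof. exact: eq_measure. Qed.

Lemma sigma_finite_tonelli (f : T1 * T2 -> \bar R) :
  measurable_fun [set: T1 * T2] f -> (forall z, 0 <= f z) ->
  \int[m]_y \int[P]_x f (x, y) = \int[P]_x \int[m]_y f (x, y).
Proof.
by move=> mf f0; rewrite mE; exact/esym/(fubini_tonelli (m1 := P) (m2 := m')).
Qed.

Lemma measurable_integral_snd (f : T1 * T2 -> \bar R) :
  measurable_fun [set: T1 * T2] f -> (forall z, 0 <= f z) ->
  measurable_fun [set: T1] (fun x => \int[m]_y f (x, y)).
Proof.
move=> mf f0; rewrite mE.
exact: (measurable_fun_fubini_tonelli_F (m2 := m')).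
Qed.

End sigma_finite_tonelli.

Lemma integral_nadd_dirac (R : realType) d (X : measurableType d)
    (X0 : set (set X)) (mu : nmeasure R X0) (x : X) (h : X -> \bar R) :
  measurable_fun [set: X] h -> (forall y, 0 <= h y) ->
  \int[nadd mu (ndirac R X0 x)]_y h y = \int[mu]_y h y + h x.
Proof.
move=> mh h0.
transitivity (\int[measure_add mu (dirac x)]_y h y).
  apply: eq_measure_integral => B mB _.
  by rewrite naddE// ndiracE//; exact/esym/measure_addE.
rewrite ge0_integral_measure_add//; congr (_ + _).
by rewrite integral_dirac// diracT mul1e.
Qed.

(** * Mecke identities for a set stable under its own points *)

Section stopping_set.
Context (R : realType) d (X : measurableType d) (X0 : set (set X)).
Hypotheses (hX : borel_space R X) (hX0 : localising_ring X0).
Local Notation N := (nmeasure R X0).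
Variables (lam : {measure set X -> \bar R}).
Hypothesis hlam : locally_finite X0 lam.
Context d' (W : measurableType d') (P : probability W R) (eta : W -> N).
Hypothesis heta : poisson_process P lam eta.
Local Notation "mu +d x" := (nadd mu (ndirac R X0 x)) (at level 50).

Variable H : N -> set X.
Hypothesis mH : measurable [set z : N * X | H z.1 z.2].
Hypothesis H_self : forall mu x, H (mu +d x) x <-> H mu x.
Hypothesis H_stable : forall mu x, H mu x -> H (mu +d x) = H mu.

Lemma locally_finite_sigma_finite : sigma_finite [set: X] lam.
Proof.
have [B_ [XB _ cB]] := localising_exhaustion hX0.
exists B_ => // n; split; first exact: (localising_measurable hX0).
exact: hlam.
Qed.

(** The integrating measure is separate from the configuration that determines the set, so one
    definition gives both S (with [m := mu]) and L (with [m := lam]). Keeping [H] abstract allows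
    the hull and also the whole space. *)
Definition stopped (m : {measure set X -> \bar R}) (g : X -> \bar R) (mu : N) :=
  \int[m]_x (g x * (\1_(H mu) x)%:E).

Local Notation S g := (fun mu : N => stopped mu g mu).
Local Notation L := (stopped lam).

Lemma measurable_stopped_integrand (g : X -> \bar R) :
  measurable_fun [set: X] g ->
  measurable_fun [set: N * X] (fun z : N * X => g z.2 * (\1_(H z.1) z.2)%:E).
Proof.
move=> mg; apply: emeasurable_funM; first exact: measurableT_comp.
apply/measurable_EFinP.
rewrite (_ : (fun z : N * X => _) = \1_[set z : N * X | H z.1 z.2]).
  exact: measurable_indic.
by apply/funext => z; rewrite !indicE; congr (_%:R); congr nat_of_bool;
  apply/idP/idP => /set_mem ?; exact/mem_set.
Qed.

Section nonnegative.
Variable g : X -> \bar R.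
Hypotheses (mg : measurable_fun [set: X] g) (g0 : forall x, 0 <= g x).

Lemma stopped_integrand_ge0 (A : set X) x : 0 <= g x * (\1_A x)%:E.
Proof. by rewrite mule_ge0// lee_fin. Qed.

Lemma stopped_ge0 m mu : 0 <= stopped m g mu.
Proof. by apply: integral_ge0 => x _; exact: stopped_integrand_ge0. Qed.

Lemma measurable_stopped_self : measurable_fun [set: N] (S g).
Proof.
apply: (measurable_integral_nmeasure hX0
  (h := fun z : N * X => g z.2 * (\1_(H z.1) z.2)%:E)).
- by move=> z; exact: stopped_integrand_ge0.
- exact: measurable_stopped_integrand.
Qed.

Lemma measurable_stopped : measurable_fun [set: N] (L g).
Proof.
apply: (measurable_integral_snd locally_finite_sigma_finite
  (f := fun z : N * X => g z.2 * (\1_(H z.1) z.2)%:E)).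
- exact: measurable_stopped_integrand.
- by move=> z; exact: stopped_integrand_ge0.
Qed.

Lemma measurable_stopped_section mu :
  measurable_fun [set: X] (fun x => g x * (\1_(H mu) x)%:E).
Proof.
by have := measurable_fun_pair2 mu (measurable_stopped_integrand mg).
Qed.

(** After the Mecke formula everything is evaluated at [eta +d x]. [H_self] removes the added point
    from the condition that [x] lies in [H], and [v] records its effect on [u]: none for the first
    moment, an increment [g x] for the second. *)
Lemma mecke_stopped (u : N -> \bar R) (v : N * X -> \bar R) :
  measurable_fun [set: N] u -> (forall mu, 0 <= u mu) ->
  measurable_fun [set: N * X] v -> (forall z, 0 <= v z) ->
  (forall mu x, H mu x -> u (mu +d x) = v (mu, x)) ->
  \int[P]_w (u (eta w) * S g (eta w)) =
  \int[P]_w \int[lam]_x (v (eta w, x) * (g x * (\1_(H (eta w)) x)%:E)).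
Proof.
move=> mu_ u0 mv v0 uv; have meta := poisson_measurable heta.
transitivity (\int[P]_w \int[eta w]_x
    (u (eta w) * (g x * (\1_(H (eta w)) x)%:E))).
  apply: eq_integral => w _; rewrite ge0_integralZl//.
  - exact: measurable_stopped_section.
  - by move=> x _; exact: stopped_integrand_ge0.
rewrite (mecke hX0 hlam heta
    (h := fun z : N * X => u z.1 * (g z.2 * (\1_(H z.1) z.2)%:E))); last 2 first.
- apply: emeasurable_funM; first exact: measurableT_comp.
  exact: measurable_stopped_integrand.
- by move=> z; rewrite mule_ge0// stopped_integrand_ge0.
rewrite -(sigma_finite_tonelli P locally_finite_sigma_finite
  (f := fun z : W * X =>
    v (eta z.1, z.2) * (g z.2 * (\1_(H (eta z.1)) z.2)%:E))); last 2 first.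
- have mez : measurable_fun [set: W * X] (fun z : W * X => (eta z.1, z.2)).
    by apply/measurable_fun_pair => //; exact: measurableT_comp.
  apply: emeasurable_funM; first exact: (measurableT_comp mv mez).
  exact: (measurableT_comp (measurable_stopped_integrand mg) mez).
- by move=> z; rewrite mule_ge0// stopped_integrand_ge0.
apply: eq_integral => x _; apply: eq_integral => w _ /=; rewrite !indicE.
have [Hx|nHx] := pselect (H (eta w) x).
  by rewrite uv// !mem_set//; exact/H_self.
by rewrite !memNset ?mule0//; apply: contra_not nHx => /H_self.
Qed.

Lemma mecke_stopped1 (u : N -> \bar R) :
  measurable_fun [set: N] u -> (forall mu, 0 <= u mu) ->
  (forall mu x, H mu x -> u (mu +d x) = u mu) ->
  \int[P]_w (u (eta w) * S g (eta w)) = \int[P]_w (u (eta w) * L g (eta w)).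
Proof.
move=> mu_ u0 uH.
rewrite (mecke_stopped (v := fun z : N * X => u z.1))//; last first.
  exact: (measurableT_comp mu_ measurable_fst).
apply: eq_integral => w _; rewrite /= ge0_integralZl//.
- exact: measurable_stopped_section.
- by move=> x _; exact: stopped_integrand_ge0.
Qed.

Lemma stopped_nadd_dirac mu x : H mu x ->
  stopped (mu +d x) g (mu +d x) = stopped mu g mu + g x.
Proof.
move=> Hx; rewrite /stopped H_stable// integral_nadd_dirac//.
- by rewrite indicE mem_set// mule1.
- exact: measurable_stopped_section.
- by move=> y; exact: stopped_integrand_ge0.
Qed.

End nonnegative.

(** Taking u = S, an added point of the set contributes [g x], which yields E[S L] + E L(g^2).
    Taking then u = L, unaffected by such a point, turns E[S L] into E L^2. *)
Lemma mecke_stopped2 (g : X -> \bar R) :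
  measurable_fun [set: X] g -> (forall x, 0 <= g x) ->
  \int[P]_w (S g (eta w) * S g (eta w)) =
  \int[P]_w (L g (eta w) * L g (eta w)) +
  \int[P]_w L (fun x => g x * g x) (eta w).
Proof.
move=> mg g0; have meta := poisson_measurable heta.
have mS := measurable_stopped_self mg g0; have mL := measurable_stopped mg g0.
rewrite (mecke_stopped mg g0 (u := S g) (v := fun z : N * X => S g z.1 + g z.2)).
- have E w : \int[lam]_x ((S g (eta w) + g x) * (g x * (\1_(H (eta w)) x)%:E)) =
      S g (eta w) * L g (eta w) + L (fun x => g x * g x) (eta w).
    have mgH := measurable_stopped_section mg (eta w).
    have gH0 x : 0 <= g x * (\1_(H (eta w)) x)%:E by exact: stopped_integrand_ge0.
    under eq_integral do rewrite ge0_muleDl ?stopped_ge0//.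
    rewrite ge0_integralD//.
    + rewrite ge0_integralZl ?stopped_ge0//; congr (_ + _).
      by apply: eq_integral => x _; rewrite muleA.
    + by move=> x _; rewrite mule_ge0 ?stopped_ge0.
    + exact: measurable_funeM.
    + by move=> x _; rewrite mule_ge0.
    + exact: emeasurable_funM.
  under eq_integral do rewrite E.
  have gg0 x : 0 <= g x * g x by rewrite mule_ge0.
  have SL0 w : 0 <= S g (eta w) * L g (eta w).
    by rewrite mule_ge0 ?stopped_ge0.
  have mSL : measurable_fun [set: W] (fun w => S g (eta w) * L g (eta w)).
    apply: emeasurable_funM; first exact: (measurableT_comp mS meta).
    exact: (measurableT_comp mL meta).
  have L20 w : 0 <= L (fun x => g x * g x) (eta w).
    by apply: integral_ge0 => x _; rewrite mule_ge0// lee_fin.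
  have mL2 :=
    measurableT_comp (measurable_stopped (emeasurable_funM mg mg) gg0) meta.
  rewrite (ge0_integralD P measurableT (fun w _ => SL0 w) mSL
    (fun w _ => L20 w) mL2).
  congr adde.
  under eq_integral do rewrite muleC.
  rewrite (mecke_stopped1 mg g0 (u := L g))//.
  + by move=> mu; exact: stopped_ge0.
  + by move=> mu x Hx; rewrite /stopped H_stable.
- exact: mS.
- by move=> mu; exact: stopped_ge0.
- apply: emeasurable_funD.
    exact: (measurableT_comp mS measurable_fst).
  exact: (measurableT_comp mg measurable_snd).
- by move=> z; rewrite adde_ge0// stopped_ge0.
- by move=> mu x Hx /=; exact: stopped_nadd_dirac.
Qed.

End stopping_set.

Lemma ge0_integral_sqrD (R : realType) d (T : measurableType d)
    (m : {measure set T -> \bar R}) (f g : T -> \bar R) :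
  measurable_fun [set: T] f -> measurable_fun [set: T] g ->
  (forall t, 0 <= f t) -> (forall t, 0 <= g t) ->
  \int[m]_t ((f t + g t) * (f t + g t)) =
  \int[m]_t (f t * f t) + (\int[m]_t (f t * g t) + \int[m]_t (f t * g t)) +
  \int[m]_t (g t * g t).
Proof.
move=> mf mg f0 g0.
have E t : (f t + g t) * (f t + g t) =
    f t * f t + (f t * g t + f t * g t) + g t * g t.
  rewrite ge0_muleDl// !ge0_muleDr// [g t * f t]muleC.
  by rewrite -!addeA.
under eq_integral do rewrite E.
have fg0 t : 0 <= f t * g t by rewrite mule_ge0.
have mfg : measurable_fun [set: T] (fun t => f t * g t) by exact: emeasurable_funM.
rewrite ge0_integralD//; last 4 first.
- by move=> t _; rewrite !adde_ge0// mule_ge0.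
- by apply: emeasurable_funD; [exact: emeasurable_funM|exact: emeasurable_funD].
- by move=> t _; rewrite mule_ge0.
- exact: emeasurable_funM.
rewrite ge0_integralD//; last 4 first.
- by move=> t _; rewrite mule_ge0.
- exact: emeasurable_funM.
- by move=> t _; rewrite adde_ge0.
- exact: emeasurable_funD.
by rewrite ge0_integralD.
Qed.

(** * The predictor and its second moment *)

Section hull_moments.
Context (R : realType) d (X : measurableType d) (X0 : set (set X)).
Hypotheses (hX : borel_space R X) (hX0 : localising_ring X0).
Local Notation N := (nmeasure R X0).
Variables (gen : N -> N).
Hypothesis hgen : generator gen.
Variables (lam : {measure set X -> \bar R}).
Hypothesis hlam : locally_finite X0 lam.
Context d' (W : measurableType d') (P : probability W R) (eta : W -> N).
Hypothesis heta : poisson_process P lam eta.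
Local Notation "mu +d x" := (nadd mu (ndirac R X0 x)) (at level 50).
Local Notation H := (hull gen).
Local Notation L := (stopped H lam).
Local Notation S g mu := (stopped H mu g mu).

Let mgen := gen_measurable hgen.
Let meta := poisson_measurable heta.
Let mH := measurable_hull_graph hX hX0 hgen.
Let H_self := hull_nadd_dirac_self hX hX0 hgen.
Let H_stable := hull_nadd_dirac hX0 hgen.

Lemma stopped_gen m g mu : stopped H m g (gen mu) = stopped H m g mu.
Proof. by rewrite /stopped (hull_gen hX0 hgen). Qed.

Lemma measurable_integral_fixed (g : X -> \bar R) :
  measurable_fun [set: X] g -> (forall x, 0 <= g x) ->
  measurable_fun [set: N] (fun mu => \int[mu]_x g x).
Proof.
move=> mg g0; apply: (measurable_integral_nmeasure hX0 (h := g \o snd)).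
  by move=> z; exact: g0.
exact: (measurableT_comp mg measurable_snd).
Qed.

Lemma integral_gen_hull (mu : N) (g : X -> \bar R) :
  measurable_fun [set: X] g -> (forall x, 0 <= g x) ->
  \int[mu]_x g x = \int[gen mu]_x g x + S g mu.
Proof.
move=> mg g0; have mHm := hull_measurable hX hX0 hgen mu.
have mHc : measurable (~` H mu) by exact: measurableC.
have split_int (m : {measure set X -> \bar R}) : \int[m]_x g x =
    \int[m]_(x in ~` H mu) g x + \int[m]_(x in H mu) g x.
  rewrite -ge0_integral_setU//; first by rewrite setvU.
    by rewrite setvU.
  by rewrite disj_set2E setICl.
rewrite split_int; congr (_ + _); last first.
  by rewrite integral_mkcond epatch_indic.
rewrite (split_int (gen mu)) [X in _ + X]null_set_integral//.
- rewrite adde0; apply: eq_measure_integral => A mA AH.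
  rewrite (genE hX hX0 hgen)//; congr (mu _).
  by rewrite setDE setIidl.
- exact: measurable_funTS.
- by rewrite (genE hX hX0 hgen)// setDv measure0.
Qed.

(** Meant to be evaluated at [nu = gen mu]. Since [mu] and [gen mu] have the same hull, the second
    term is then the integral over the hull of [mu]. *)
Definition predictor (g : X -> \bar R) (nu : N) := \int[nu]_x g x + L g nu.

Let U := [set z : W * X | H (eta z.1) z.2].

Let mU : measurable U.
Proof.
have mez : measurable_fun [set: W * X] (fun z : W * X => (eta z.1, z.2)).
  by apply/measurable_fun_pair => //; exact: measurableT_comp.
by have := mez measurableT _ mH; rewrite setTI.
Qed.

Let gen_neqE x : [set w | gen (eta w +d x) <> gen (eta w)] = ~` ysection U x.
Proof. by rewrite ysectionE. Qed.

Lemma measurable_prob_gen_neq :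
  measurable_fun [set: X] (fun x => P [set w | gen (eta w +d x) <> gen (eta w)]).
Proof.
have := measurable_fun_ysection P (measurableC mU).
by congr measurable_fun; apply/funext => x; rewrite /= gen_neqE !ysectionE.
Qed.

(** By Tonelli the expected hull integral is the integral of h(x) P(x in H(eta)), complementary to
    the first term. The sum form holds even when both sides are infinite. *)
Lemma integral_stopped_gen_neq (h : X -> \bar R) :
  measurable_fun [set: X] h -> (forall x, 0 <= h x) ->
  \int[lam]_x (h x * P [set w | gen (eta w +d x) <> gen (eta w)]) +
  \int[P]_w L h (eta w) = \int[lam]_x h x.
Proof.
move=> mh h0.
rewrite /stopped -(sigma_finite_tonelli P (locally_finite_sigma_finite hX0 hlam)
  (f := fun z : W * X => h z.2 * (\1_(H (eta z.1)) z.2)%:E)); last 2 first.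
- have mez : measurable_fun [set: W * X] (fun z : W * X => (eta z.1, z.2)).
    by apply/measurable_fun_pair => //; exact: measurableT_comp.
  exact: (measurableT_comp (measurable_stopped_integrand mH mh) mez).
- by move=> z; rewrite stopped_integrand_ge0.
have mq := measurable_fun_ysection P mU.
have mUx x : measurable (ysection U x) by exact: measurable_ysection.
have indU x : (fun w => (\1_(H (eta w)) x)%:E : \bar R) =
    EFin \o \1_(ysection U x).
  apply/funext => w /=; rewrite !indicE; congr (_%:R%:E); congr nat_of_bool.
  apply/idP/idP => [/set_mem Hx|]; first by rewrite mem_ysection; exact/mem_set.
  by rewrite mem_ysection => /set_mem Hx; exact/mem_set.
have E x : \int[P]_w (h x * (\1_(H (eta w)) x)%:E) = h x * P (ysection U x).
  rewrite ge0_integralZl//.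
  - by rewrite [X in _ * integral _ _ X]indU integral_indic// setIT.
  - by rewrite indU; exact/measurable_EFinP/measurable_indic.
under [X in _ + X]eq_integral do rewrite E.
rewrite -ge0_integralD//.
- apply: eq_integral => x _; rewrite -ge0_muleDr// gen_neqE.
  by rewrite probability_setC// subeK ?mule1//; exact: fin_num_measure.
- by move=> x _; rewrite mule_ge0.
- by apply: emeasurable_funM => //; exact: measurable_prob_gen_neq.
- by move=> x _; rewrite mule_ge0.
- exact: emeasurable_funM.
Qed.

Section nonnegative.
Variable g : X -> \bar R.
Hypotheses (mg : measurable_fun [set: X] g) (g0 : forall x, 0 <= g x).

Let Lg0 mu : 0 <= L g mu. Proof. exact: stopped_ge0. Qed.
Let Sg0 (mu : N) : 0 <= S g mu. Proof. exact: stopped_ge0. Qed.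
Let Tg0 (mu : N) : 0 <= \int[mu]_x g x. Proof. exact: integral_ge0. Qed.

Let mL : measurable_fun [set: N] (L g).
Proof. exact: (measurable_stopped hX0 hlam mH mg g0). Qed.

Let mS : measurable_fun [set: N] (fun mu : N => S g mu).
Proof. exact: (measurable_stopped_self hX0 mH mg g0). Qed.

Let mT : measurable_fun [set: N] (fun mu : N => \int[gen mu]_x g x).
Proof. exact: (measurableT_comp (measurable_integral_fixed mg g0) mgen). Qed.

Lemma predictor_ge0 nu : 0 <= predictor g nu.
Proof. by rewrite adde_ge0. Qed.

Lemma measurable_predictor : measurable_fun [set: N] (predictor g).
Proof. by apply: emeasurable_funD => //; exact: measurable_integral_fixed. Qed.

Lemma predictor_gen mu : predictor g (gen mu) = \int[gen mu]_x g x + L g mu.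
Proof. by rewrite /predictor stopped_gen. Qed.

(** The event becomes the weight [u], the indicator of [A] at [gen mu]. A point of the hull leaves
    it unchanged, so S may be exchanged for L under this weight. *)
Lemma condexp_predictor A : measurable A ->
  \int[P]_(w in (gen \o eta) @^-1` A) \int[eta w]_x g x =
  \int[P]_(w in (gen \o eta) @^-1` A) predictor g (gen (eta w)).
Proof.
move=> mA; pose u (mu : N) : \bar R := (\1_A (gen mu))%:E.
have mu_ : measurable_fun [set: N] u.
  by apply/measurable_EFinP; exact: (measurableT_comp (measurable_indic mA) mgen).
have u0 mu : 0 <= u mu by rewrite lee_fin.
have uH mu x : H mu x -> u (mu +d x) = u mu by rewrite /u => ->.
have E (h : W -> \bar R) : \int[P]_(w in (gen \o eta) @^-1` A) h w =
    \int[P]_w (u (eta w) * h w).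
  rewrite integral_mkcond epatch_indic; apply: eq_integral => w _.
  by rewrite /= muleC.
rewrite !E.
have mue := measurableT_comp mu_ meta.
have mTe := measurableT_comp mT meta.
have mSe := measurableT_comp mS meta.
have mLe := measurableT_comp mL meta.
transitivity (\int[P]_w (u (eta w) * \int[gen (eta w)]_x g x) +
              \int[P]_w (u (eta w) * S g (eta w))).
  rewrite -ge0_integralD//.
  - by apply: eq_integral => w _; rewrite integral_gen_hull// ge0_muleDr ?Tg0 ?Sg0.
  - by move=> w _; rewrite mule_ge0.
  - exact: emeasurable_funM.
  - by move=> w _; rewrite mule_ge0.
  - exact: emeasurable_funM.
rewrite (mecke_stopped1 hX0 hlam heta mH H_self mg g0 mu_ u0 uH).
rewrite -ge0_integralD//.
- by apply: eq_integral => w _; rewrite predictor_gen -ge0_muleDr ?Tg0 ?Lg0.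
- by move=> w _; rewrite mule_ge0.
- exact: emeasurable_funM.
- by move=> w _; rewrite mule_ge0.
- exact: emeasurable_funM.
Qed.

(** The whole space trivially satisfies the stability hypotheses, and [mecke_stopped2] for it is the
    classical formula. *)
Lemma poisson_second_moment :
  \int[P]_w (\int[eta w]_x g x * \int[eta w]_x g x) =
  \int[lam]_x g x * \int[lam]_x g x + \int[lam]_x (g x * g x).
Proof.
have sT m h (mu : N) : stopped (fun=> [set: X]) m h mu = \int[m]_x h x.
  by apply: eq_integral => x _; rewrite indicT mule1.
have mHT : measurable [set z : N * X | (fun=> [set: X]) z.1 z.2].
  by rewrite (_ : mkset _ = setT)//; apply/seteqP; split.
transitivity (\int[P]_w (stopped (fun=> [set: X]) (eta w) g (eta w) *
                       stopped (fun=> [set: X]) (eta w) g (eta w))).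
  by apply: eq_integral => w _; rewrite sT.
rewrite (mecke_stopped2 hX0 hlam heta mHT)//; congr (_ + _).
  rewrite [LHS](eq_integral (cst (\int[lam]_x g x * \int[lam]_x g x))).
    by rewrite integral_cst// [X in _ * X]probability_setT mule1.
  by move=> w _; rewrite !sT.
rewrite [LHS](eq_integral (cst (\int[lam]_x (g x * g x)))).
  by rewrite integral_cst// [X in _ * X]probability_setT mule1.
by move=> w _; rewrite sT.
Qed.

(** With T the integral against [gen mu], expand (T + S)^2 and (T + L)^2. The cross terms have equal
    means, T being unchanged by points of the hull, and E S^2 exceeds E L^2 by the hull integral of
    g^2. *)
Lemma predictor_second_moment :
  \int[P]_w (predictor g (gen (eta w)) * predictor g (gen (eta w))) +
  \int[P]_w L (fun x => g x * g x) (eta w) =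
  \int[lam]_x g x * \int[lam]_x g x + \int[lam]_x (g x * g x).
Proof.
rewrite -poisson_second_moment.
have mTe := measurableT_comp mT meta.
have mSe := measurableT_comp mS meta.
have mLe := measurableT_comp mL meta.
have E : \int[P]_w (\int[eta w]_x g x * \int[eta w]_x g x) =
    \int[P]_w ((\int[gen (eta w)]_x g x + S g (eta w)) *
               (\int[gen (eta w)]_x g x + S g (eta w))).
  by apply: eq_integral => w _; rewrite integral_gen_hull.
have FF := ge0_integral_sqrD P mTe mSe (fun w => Tg0 _) (fun w => Sg0 _).
have VV := ge0_integral_sqrD P mTe mLe (fun w => Tg0 _) (fun w => Lg0 _).
rewrite {}E [RHS]FF.
rewrite [X in X + _](_ : _ = \int[P]_w ((\int[gen (eta w)]_x g x + L g (eta w)) *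
    (\int[gen (eta w)]_x g x + L g (eta w)))); last first.
  by apply: eq_integral => w _; rewrite predictor_gen.
rewrite [X in X + _]VV /=.
rewrite (mecke_stopped1 hX0 hlam heta mH H_self mg g0
  (u := fun mu => \int[gen mu]_x g x) mT (fun mu => Tg0 _));
  last by move=> mu x ->.
by rewrite (mecke_stopped2 hX0 hlam heta mH H_self H_stable mg g0)// -addeA.
Qed.

Lemma predictor_variance : \int[lam]_x (g x * g x) < +oo ->
  \int[P]_w (predictor g (gen (eta w)) * predictor g (gen (eta w))) =
  \int[lam]_x g x * \int[lam]_x g x +
  \int[lam]_x (g x * g x * P [set w | gen (eta w +d x) <> gen (eta w)]).
Proof.
move=> g2oo; have gg0 x : 0 <= g x * g x by rewrite mule_ge0.
have := predictor_second_moment.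
rewrite -(integral_stopped_gen_neq (emeasurable_funM mg mg) gg0) [RHS]addeA => E.
(* The term common to both sides is at most the integral of g^2, hence finite and cancellable. *)
have L2fin : \int[P]_w L (fun x => g x * g x) (eta w) \is a fin_num.
  rewrite ge0_fin_numE; last by apply: integral_ge0 => w _; exact: stopped_ge0.
  apply: le_lt_trans g2oo.
  rewrite -(integral_stopped_gen_neq (emeasurable_funM mg mg) gg0) leeDr//.
  by apply: integral_ge0 => x _; rewrite mule_ge0.
by rewrite -[LHS](addeK _ L2fin) E addeK.
Qed.

End nonnegative.
End hull_moments.

(** * Conditional expectations and the variance formula *)

Section real_valued_versions.
Context (R : realType) d (T : measurableType d) (P : probability T R).

Lemma Lfun2P (h : T -> R) : measurable_fun [set: T] h ->
  \int[P]_w (h w ^+ 2)%:E < +oo -> h \in Lfun P 2%:E.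
Proof.
move=> mh h2; apply/andP; split; first exact/mem_set.
apply/mem_set; rewrite /= /finite_norm unlock /Lnorm; apply: poweR_lty.
apply: le_lt_trans h2; apply: ge0_le_integral => //.
- by move=> w _; exact: poweR_ge0.
- apply: (measurableT_comp (measurable_poweR _)).
  by apply/measurable_EFinP; exact: measurableT_comp.
- by apply/measurable_EFinP; exact: measurable_funX.
- by move=> w _ /=; rewrite lee_fin powR_mulrn// -normrX ger0_norm// sqr_ge0.
Qed.

(** Predictors take values in the extended half-line, conditional expectations in the reals. [fine]
    sends +oo to 0, which matters only on a null set when the mean is finite. *)
Lemma ae_fine (h : T -> \bar R) : measurable_fun [set: T] h ->
  (forall w, 0 <= h w) -> \int[P]_w h w < +oo ->
  {ae P, forall w, (fine (h w))%:E = h w}.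
Proof.
move=> mh h0 hoo.
have ih : P.-integrable [set: T] h.
  apply/integrableP; split => //.
  by under eq_integral do rewrite gee0_abs//.
have := integrable_ae measurableT ih.
by apply: filterS => w hw; rewrite fineK// hw.
Qed.

Lemma integrable_fine_ge0 (h : T -> \bar R) : measurable_fun [set: T] h ->
  (forall w, 0 <= h w) -> \int[P]_w h w < +oo ->
  P.-integrable [set: T] (EFin \o (fine \o h)).
Proof.
move=> mh h0 hoo; apply/integrableP; split.
  by apply/measurable_EFinP; exact: measurableT_comp.
apply: le_lt_trans hoo; apply: ge0_le_integral => //.
  apply: measurableT_comp => //.
  by apply/measurable_EFinP; exact: measurableT_comp.
move=> w _ /=; rewrite ger0_norm ?fine_ge0//.
by case: (h w) (h0 w) => //= _; rewrite leey.
Qed.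

Lemma integral_fine_ge0 (h : T -> \bar R) C : measurable_fun [set: T] h ->
  (forall w, 0 <= h w) -> \int[P]_w h w < +oo -> measurable C ->
  \int[P]_(w in C) (fine (h w))%:E = \int[P]_(w in C) h w.
Proof.
move=> mh h0 hoo mC; apply: ge0_ae_eq_integral => //.
- by apply: measurable_funTS; apply/measurable_EFinP; exact: measurableT_comp.
- exact: measurable_funTS.
- by move=> w _; rewrite lee_fin fine_ge0.
- by have := ae_fine mh h0 hoo; apply: filterS => w + _.
Qed.

Lemma integral_fineB (a b : T -> \bar R) C : measurable C ->
  measurable_fun [set: T] a -> measurable_fun [set: T] b ->
  (forall w, 0 <= a w) -> (forall w, 0 <= b w) ->
  \int[P]_w a w < +oo -> \int[P]_w b w < +oo ->
  \int[P]_(w in C) (fine (a w) - fine (b w))%:E =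
  \int[P]_(w in C) a w - \int[P]_(w in C) b w.
Proof.
move=> mC ma mb a0 b0 aoo boo.
have ia := integrable_fine_ge0 ma a0 aoo.
have ib := integrable_fine_ge0 mb b0 boo.
transitivity
    (\int[P]_(w in C) ((EFin \o (fine \o a)) \- (EFin \o (fine \o b))) w).
  by apply: eq_integral => w _; rewrite /= EFinB.
rewrite integralB//; [|exact: integrableS ia|exact: integrableS ib].
by rewrite /= !integral_fine_ge0.
Qed.

Lemma integral_fine_sqr (h : T -> \bar R) : measurable_fun [set: T] h ->
  (forall w, 0 <= h w) -> \int[P]_w h w < +oo ->
  \int[P]_w (fine (h w) ^+ 2)%:E = \int[P]_w (h w * h w).
Proof.
move=> mh h0 hoo; apply: ge0_ae_eq_integral => //.
- by apply/measurable_EFinP; apply: measurable_funX; exact: measurableT_comp.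
- exact: emeasurable_funM.
- by move=> w _; rewrite lee_fin sqr_ge0.
- by move=> w _; rewrite mule_ge0.
- by apply: filterS (ae_fine mh h0 hoo) => w E _; rewrite expr2 EFinM E.
Qed.

End real_valued_versions.

(** * Almost sure uniqueness of conditional expectations *)

Section conditional_expectation.
Context (R : realType) d (W : measurableType d) (P : probability W R).
Context d' (T : measurableType d') (Z : W -> T).
Hypothesis mZ : measurable_fun [set: W] Z.

Lemma preimage_sigma_measurable C : g_sigma_algebra_preimage Z C -> measurable C.
Proof. by move=> [B mB <-]; exact: mZ. Qed.

Lemma condexp_negligible (G1 G2 : W -> R) :
  P.-integrable [set: W] (EFin \o G1) -> P.-integrable [set: W] (EFin \o G2) ->
  (forall E : set R, measurable E -> g_sigma_algebra_preimage Z (G1 @^-1` E)) ->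
  (forall E : set R, measurable E -> g_sigma_algebra_preimage Z (G2 @^-1` E)) ->
  (forall C, g_sigma_algebra_preimage Z C ->
    \int[P]_(w in C) (G1 w)%:E = \int[P]_(w in C) (G2 w)%:E) ->
  {ae P, forall w, (G1 w <= G2 w)%R}.
Proof.
move=> i1 i2 s1 s2 E12.
pose C := [set w | (G2 w < G1 w)%R].
have sC : g_sigma_algebra_preimage Z C.
  pose W' := g_sigma_algebra_preimageType Z.
  have m1 : measurable_fun [set: W'] (G1 : W' -> R).
    by move=> _ E mE; rewrite setTI; exact: s1.
  have m2 : measurable_fun [set: W'] (G2 : W' -> R).
    by move=> _ E mE; rewrite setTI; exact: s2.
  have := measurable_funB m1 m2 measurableT (measurable_itv `]0%R, +oo[).
  rewrite setTI; congr (measurable _).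
  by apply/seteqP; split => w; rewrite /C/= in_itv/= andbT subr_gt0.
have mC := preimage_sigma_measurable sC.
have mG1 : measurable_fun [set: W] (EFin \o G1) by case/integrableP: i1.
have mG2 : measurable_fun [set: W] (EFin \o G2) by case/integrableP: i2.
have i1C : P.-integrable C (EFin \o G1) by exact: integrableS i1.
have i2C : P.-integrable C (EFin \o G2) by exact: integrableS i2.
have I0 : \int[P]_(w in C) `|(G1 w - G2 w)%:E| = 0.
  transitivity (\int[P]_(w in C) ((G1 w)%:E - (G2 w)%:E)).
    apply: eq_integral => w /set_mem Cw.
    by rewrite -EFinB gee0_abs// lee_fin subr_ge0 ltW.
  rewrite integralB// E12// subee//.
  exact: integrable_fin_num.
have mB : measurable_fun C (fun w => (G1 w - G2 w)%:E).
  apply: measurable_funTS; apply/measurable_EFinP; apply: measurable_funB.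
    exact/measurable_EFinP.
  exact/measurable_EFinP.
have /ae_eq_integral_abs := I0; move=> /(_ mC mB).
apply: filterS => w /= wC; rewrite leNgt; apply/negP => Cw.
have := wC Cw => -[] /eqP; rewrite subr_eq0 => /eqP G12.
by move: Cw; rewrite G12 ltxx.
Qed.

Lemma condexp_unique (G1 G2 : W -> R) :
  P.-integrable [set: W] (EFin \o G1) -> P.-integrable [set: W] (EFin \o G2) ->
  (forall E : set R, measurable E -> g_sigma_algebra_preimage Z (G1 @^-1` E)) ->
  (forall E : set R, measurable E -> g_sigma_algebra_preimage Z (G2 @^-1` E)) ->
  (forall C, g_sigma_algebra_preimage Z C ->
    \int[P]_(w in C) (G1 w)%:E = \int[P]_(w in C) (G2 w)%:E) ->
  {ae P, forall w, G1 w = G2 w}.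
Proof.
move=> i1 i2 s1 s2 E12.
have := condexp_negligible i1 i2 s1 s2 E12.
have E21 C : g_sigma_algebra_preimage Z C ->
    \int[P]_(w in C) (G2 w)%:E = \int[P]_(w in C) (G1 w)%:E by move=> /E12.
have := condexp_negligible i2 i1 s2 s1 E21.
by apply: filterS2 => w le21 le12; apply/le_anti/andP.
Qed.

End conditional_expectation.

(** * Signed integrands and the variance *)

Section predictor_sum.
Context (R : realType) d (X : measurableType d) (X0 : set (set X)).
Hypotheses (hX : borel_space R X) (hX0 : localising_ring X0).
Local Notation N := (nmeasure R X0).
Variables (gen : N -> N).
Hypothesis hgen : generator gen.
Variables (lam : {measure set X -> \bar R}).

Lemma predictorD (g h : X -> \bar R) (nu : N) :
  measurable_fun [set: X] g -> measurable_fun [set: X] h ->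
  (forall x, 0 <= g x) -> (forall x, 0 <= h x) ->
  predictor gen lam (g \+ h) nu = predictor gen lam g nu + predictor gen lam h nu.
Proof.
move=> mg mh g0 h0; rewrite /predictor ge0_integralD// addeACA; congr (_ + _).
have mH := hull_measurable hX hX0 hgen nu.
have m1 : measurable_fun [set: X] (fun x => (\1_(hull gen nu) x)%:E : \bar R).
  by apply/measurable_EFinP; exact: measurable_indic.
rewrite /stopped -ge0_integralD//.
- by apply: eq_integral => x _; rewrite ge0_muleDl.
- by move=> x _; rewrite mule_ge0// lee_fin.
- exact: emeasurable_funM.
- by move=> x _; rewrite mule_ge0// lee_fin.
- exact: emeasurable_funM.
Qed.

End predictor_sum.

Theorem theorem5p1 (R : realType)
    (d : measure_display) (X : measurableType d) (X0 : set (set X))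
    (hX : borel_space R X) (hX0 : localising_ring X0)
    (gen : nmeasure R X0 -> nmeasure R X0) (hgen : generator gen)
    (lam : {measure set X -> \bar R}) (hlam : locally_finite X0 lam)
    (d' : measure_display) (W : measurableType d') (P : probability W R)
    (eta : W -> nmeasure R X0) (heta : poisson_process P lam eta)
    (hgeta : {ae P, forall w, gen (eta w) [set: X] < +oo} \/
             strong_markov hX0 P lam gen eta)
    (f : X -> R) (hf1 : f \in Lfun lam 1) (hf2 : f \in Lfun lam 2%:E)
    (Fhat : W -> R)
    (hFhat : is_condexp P (gen \o eta) (fun w => \int[eta w]_x f x)%R Fhat) :
  Fhat \in Lfun P 2%:E /\
  'V_P[Fhat] = \int[lam]_x ((f x ^+ 2)%:E *
    P [set w | gen (nadd (eta w) (ndirac R X0 x)) <> gen (eta w)]).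
Proof.
clear hgeta; case: hFhat => iFhat sFhat eFhat.
have meta := poisson_measurable heta; have mgen := gen_measurable hgen.
have mZ : measurable_fun [set: W] (gen \o eta) by exact: measurableT_comp.
have iF : lam.-integrable [set: X] (EFin \o f) by exact/Lfun1_integrable.
have iF2 := Lfun2_integrable_sqr hf2.
have mF : measurable_fun [set: X] (EFin \o f) by case/integrableP: iF.
pose p x := P [set w | gen (nadd (eta w) (ndirac R X0 x)) <> gen (eta w)].
pose gp : X -> \bar R := (EFin \o f)^\+.
pose gm : X -> \bar R := (EFin \o f)^\-.
have mgp : measurable_fun [set: X] gp by exact: measurable_funepos.
have mgm : measurable_fun [set: X] gm by exact: measurable_funeneg.
have gp0 x : 0 <= gp x by exact: funepos_ge0.
have gm0 x : 0 <= gm x by exact: funeneg_ge0.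
pose ga := gp \+ gm.
have mga : measurable_fun [set: X] ga by exact: emeasurable_funD.
have ga0 x : 0 <= ga x by exact: adde_ge0.
have gpE x : gp x = (Num.max (f x) 0)%:E by rewrite /gp funeposE EFin_max.
have gmE x : gm x = (Num.max (- f x) 0)%:E by rewrite /gm funenegE EFin_max.
(* At every point one of [gp], [gm] vanishes, so the sum of the squares and the square of the sum
   are both [f x ^+ 2]. *)
have gpm2 x : gp x * gp x + gm x * gm x = (f x ^+ 2)%:E.
  rewrite gpE gmE -!EFinM -EFinD; congr EFin.
  have [f0|f0] := leP 0%R (f x).
    by rewrite max_r ?oppr_le0// mulr0 addr0 expr2.
  by rewrite max_l ?oppr_ge0 ?ltW// mulr0 add0r mulrNN expr2.
have ga2 x : ga x * ga x = (f x ^+ 2)%:E.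
  rewrite /ga/= gpE gmE -!EFinD -EFinM; congr EFin.
  have [f0|f0] := leP 0%R (f x).
    by rewrite max_r ?oppr_le0// addr0 expr2.
  by rewrite max_l ?oppr_ge0 ?ltW// add0r mulrNN expr2.
have intgp : \int[lam]_x gp x < +oo by exact: integral_funepos_lt_pinfty.
have intgm : \int[lam]_x gm x < +oo by exact: integral_funeneg_lt_pinfty.
have f2oo : \int[lam]_x (f x ^+ 2)%:E < +oo.
  have /integrableP[_] := iF2; apply: le_lt_trans.
  by rewrite le_eqVlt; apply/orP; left; apply/eqP; apply: eq_integral => x _;
    rewrite gee0_abs// lee_fin sqr_ge0.
have gp2oo : \int[lam]_x (gp x * gp x) < +oo.
  apply: le_lt_trans f2oo; apply: ge0_le_integral => //.
  - by move=> x _; rewrite mule_ge0.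
  - exact: emeasurable_funM.
  - by apply/measurable_EFinP; apply: measurable_funX; exact/measurable_EFinP.
  - by move=> x _; rewrite -gpm2 leeDl// mule_ge0.
have gm2oo : \int[lam]_x (gm x * gm x) < +oo.
  apply: le_lt_trans f2oo; apply: ge0_le_integral => //.
  - by move=> x _; rewrite mule_ge0.
  - exact: emeasurable_funM.
  - by apply/measurable_EFinP; apply: measurable_funX; exact/measurable_EFinP.
  - by move=> x _; rewrite -gpm2 leeDr// mule_ge0.
have ga2oo : \int[lam]_x (ga x * ga x) < +oo.
  by under eq_integral do rewrite ga2.
pose pred g w := predictor gen lam g (gen (eta w)).
have mprd g : measurable_fun [set: X] g -> (forall x, 0 <= g x) ->
    measurable_fun [set: nmeasure R X0] (predictor gen lam g).
  by move=> mg g0; exact: measurable_predictor.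
have mpred g : measurable_fun [set: X] g -> (forall x, 0 <= g x) ->
    measurable_fun [set: W] (pred g).
  by move=> mg g0; exact: (measurableT_comp (mprd g mg g0) mZ).
have pred0 g w : (forall x, 0 <= g x) -> 0 <= pred g w.
  by move=> g0; exact: predictor_ge0.
have mint g : measurable_fun [set: X] g -> (forall x, 0 <= g x) ->
    measurable_fun [set: W] (fun w => \int[eta w]_x g x).
  move=> mg g0.
  exact: (measurableT_comp (measurable_integral_fixed hX0 mg g0) meta).
have int1 g : measurable_fun [set: X] g -> (forall x, 0 <= g x) ->
    \int[P]_w \int[eta w]_x g x = \int[lam]_x g x.
  move=> mg g0.
  rewrite (mecke hX0 hlam heta (h := fun z : nmeasure R X0 * X => g z.2)).
  - apply: eq_integral => x _ /=.
    by rewrite integral_cst// [X in _ * X]probability_setT mule1.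
  - exact: (measurableT_comp mg measurable_snd).
  - by move=> z; exact: g0.
have predC g C : measurable_fun [set: X] g -> (forall x, 0 <= g x) ->
    g_sigma_algebra_preimage (gen \o eta) C ->
    \int[P]_(w in C) \int[eta w]_x g x = \int[P]_(w in C) pred g w.
  move=> mg g0 [A mA <-]; rewrite setTI.
  exact: (condexp_predictor hX hX0 hgen hlam heta mg g0 mA).
have pred1 g : measurable_fun [set: X] g -> (forall x, 0 <= g x) ->
    \int[P]_w pred g w = \int[lam]_x g x.
  move=> mg g0; rewrite -int1//; apply/esym/predC => //.
  by exists setT => //; rewrite setTI preimage_setT.
have pred2 g : measurable_fun [set: X] g -> (forall x, 0 <= g x) ->
    \int[lam]_x (g x * g x) < +oo ->
    \int[P]_w (pred g w * pred g w) = \int[lam]_x g x * \int[lam]_x g x +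
      \int[lam]_x (g x * g x * p x).
  by move=> mg g0 g2; exact: (predictor_variance hX hX0 hgen hlam heta mg g0 g2).
pose rp w := fine (pred gp w); pose rm w := fine (pred gm w).
(* The explicit version of the conditional expectation. Passing to reals before subtracting avoids
   an undefined difference of infinities. *)
pose V w := (rp w - rm w)%R.
have irp : P.-integrable [set: W] (EFin \o rp).
  by apply: integrable_fine_ge0; rewrite ?pred1//;
    [exact: mpred|move=> w; exact: pred0].
have irm : P.-integrable [set: W] (EFin \o rm).
  by apply: integrable_fine_ge0; rewrite ?pred1//;
    [exact: mpred|move=> w; exact: pred0].
have iV : P.-integrable [set: W] (EFin \o V).
  rewrite (_ : EFin \o V = (EFin \o rp) \- (EFin \o rm)); first exact: integrableB.
  by apply/funext => w; rewrite /= EFinB.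
have sV E : measurable E -> g_sigma_algebra_preimage (gen \o eta) (V @^-1` E).
  move=> mE; pose v nu := (fine (predictor gen lam gp nu) -
    fine (predictor gen lam gm nu))%R.
  have mv : measurable_fun [set: nmeasure R X0] v.
    by apply: measurable_funB; apply: measurableT_comp => //; exact: mprd.
  exists (v @^-1` E); last by rewrite setTI.
  by rewrite -[X in measurable X]setTI; exact: mv.
have VE C : measurable C ->
    \int[P]_(w in C) (V w)%:E =
    \int[P]_(w in C) pred gp w - \int[P]_(w in C) pred gm w.
  by move=> mC; apply: integral_fineB; rewrite ?pred1//;
    by [exact: mpred|move=> w; exact: pred0].
have eV C : g_sigma_algebra_preimage (gen \o eta) C ->
    \int[P]_(w in C) (V w)%:E = \int[P]_(w in C) (\int[eta w]_x f x)%R%:E.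
  move=> sC; have mC := preimage_sigma_measurable mZ sC.
  pose Fp w := \int[eta w]_x gp x; pose Fm w := \int[eta w]_x gm x.
  have mFp : measurable_fun [set: W] Fp by exact: mint.
  have mFm : measurable_fun [set: W] Fm by exact: mint.
  have Fp0 w : 0 <= Fp w by exact: integral_ge0.
  have Fm0 w : 0 <= Fm w by exact: integral_ge0.
  have Fpoo : \int[P]_w Fp w < +oo by rewrite int1.
  have Fmoo : \int[P]_w Fm w < +oo by rewrite int1.
  rewrite VE// -!predC// -(integral_fineB (a := Fp) (b := Fm))//.
  (* The real integral of [f] against [eta w] is [fine (Fp w - Fm w)]; it equals the difference of
     the two [fine] values where both are finite, hence almost surely. *)
  apply: ae_eq_integral => //.
  - apply: measurable_funTS; apply/measurable_EFinP; apply: measurable_funB;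
      exact: measurableT_comp.
  - apply: measurable_funTS; apply/measurable_EFinP.
    rewrite (_ : (fun w => _) = fine \o (Fp \- Fm)).
      by apply: measurableT_comp => //; exact: emeasurable_funB.
    by apply/funext => w; rewrite /Rintegral integralE.
  - have := ae_fine mFm Fm0 Fmoo; have := ae_fine mFp Fp0 Fpoo.
    apply: filterS2 => w Ep Em _.
    by rewrite /Rintegral integralE -/gp -/gm -/(Fp w) -/(Fm w) -Ep -Em.
have FV : {ae P, forall w, Fhat w = V w}.
  apply: (condexp_unique mZ iFhat iV sFhat sV) => C sC.
  by rewrite eFhat// eV.
have V1 : \int[P]_w (V w)%:E = \int[lam]_x gp x - \int[lam]_x gm x.
  by rewrite VE// !pred1.
have mp : measurable_fun [set: X] p := measurable_prob_gen_neq hX hX0 hgen heta.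
have p0 x : 0 <= p x by [].
(* Dropping the nonnegative hull term in [integral_stopped_gen_neq] bounds the weighted integral by
   the unweighted one. *)
have ltp g : measurable_fun [set: X] g -> (forall x, 0 <= g x) ->
    \int[lam]_x (g x * g x) < +oo -> \int[lam]_x (g x * g x * p x) < +oo.
  move=> mg g0; apply: le_lt_trans.
  rewrite -(integral_stopped_gen_neq hX hX0 hgen hlam heta (emeasurable_funM mg mg)).
    rewrite leeDl//; apply: integral_ge0 => w _.
    by apply: stopped_ge0 => x; rewrite mule_ge0.
  by move=> x; rewrite mule_ge0.
have real_int (h : X -> \bar R) : (forall x, 0 <= h x) ->
    \int[lam]_x h x < +oo -> exists r : R, \int[lam]_x h x = r%:E.
  move=> h0 hoo; exists (fine (\int[lam]_x h x)).
  by rewrite fineK// ge0_fin_numE// integral_ge0.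
have [a aE] := real_int gp gp0 intgp.
have [b bE] := real_int gm gm0 intgm.
have [|ip ipE] := real_int _ _ (ltp gp mgp gp0 gp2oo).
  by move=> x; rewrite !mule_ge0.
have [|im imE] := real_int _ _ (ltp gm mgm gm0 gm2oo).
  by move=> x; rewrite !mule_ge0.
have IE : \int[lam]_x ((f x ^+ 2)%:E * p x) = (ip + im)%:E.
  rewrite EFinD -ipE -imE -ge0_integralD//.
  - by apply: eq_integral => x _; rewrite -gpm2 ge0_muleDl// mule_ge0.
  - by move=> x _; rewrite !mule_ge0.
  - by apply: emeasurable_funM => //; exact: emeasurable_funM.
  - by move=> x _; rewrite !mule_ge0.
  - by apply: emeasurable_funM => //; exact: emeasurable_funM.
have abE : \int[lam]_x ga x = (a + b)%:E by rewrite ge0_integralD// aE bE.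
have mrp : measurable_fun [set: W] rp.
  by apply/measurable_EFinP; case/integrableP: irp.
have mrm : measurable_fun [set: W] rm.
  by apply/measurable_EFinP; case/integrableP: irm.
have msqr (r : W -> R) : measurable_fun [set: W] r ->
    measurable_fun [set: W] (fun w => (r w ^+ 2)%:E : \bar R).
  by move=> mr; apply/measurable_EFinP; exact: measurable_funX.
have mV : measurable_fun [set: W] V.
  by apply/measurable_EFinP; case/integrableP: iV.
have aep : {ae P, forall w, (fine (pred gp w))%:E = pred gp w}.
  by apply: ae_fine; rewrite ?pred1//; [exact: mpred|move=> w; exact: pred0].
have aem : {ae P, forall w, (fine (pred gm w))%:E = pred gm w}.
  by apply: ae_fine; rewrite ?pred1//; [exact: mpred|move=> w; exact: pred0].
have rp2 : \int[P]_w (rp w ^+ 2)%:E = (a * a + ip)%:E.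
  rewrite EFinD EFinM -aE -ipE -pred2//; apply: integral_fine_sqr.
  - exact: mpred.
  - by move=> w; exact: pred0.
  - by rewrite pred1.
have rm2 : \int[P]_w (rm w ^+ 2)%:E = (b * b + im)%:E.
  rewrite EFinD EFinM -bE -imE -pred2//; apply: integral_fine_sqr.
  - exact: mpred.
  - by move=> w; exact: pred0.
  - by rewrite pred1.
(* By [predictorD], [rp + rm] is almost surely the predictor of [ga], the absolute value of [f]. *)
have ra2 : \int[P]_w ((rp w + rm w) ^+ 2)%:E =
    ((a + b) * (a + b) + (ip + im))%:E.
  rewrite EFinD EFinM -abE -IE.
  rewrite [X in _ + X](_ : _ = \int[lam]_x (ga x * ga x * p x)); last first.
    by apply: eq_integral => x _; rewrite ga2.
  rewrite -pred2//; apply: ge0_ae_eq_integral => //.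
  - by apply: msqr; exact: measurable_funD.
  - by apply: emeasurable_funM; exact: mpred.
  - by move=> w _; rewrite lee_fin sqr_ge0.
  - by move=> w _; rewrite mule_ge0// pred0.
  - have := aem; have := aep; apply: filterS2 => w Ep Em _.
    by rewrite /pred predictorD// expr2 EFinM EFinD Ep Em.
(* The three known second moments determine the fourth: 2(a^2 + ip) + 2(b^2 + im) minus (a + b)^2 +
   ip + im is (a - b)^2 + ip + im. *)
have V2 : \int[P]_w (V w ^+ 2)%:E = ((a - b) ^+ 2 + (ip + im))%:E.
  have : \int[P]_w (V w ^+ 2)%:E + \int[P]_w ((rp w + rm w) ^+ 2)%:E =
      \int[P]_w (rp w ^+ 2)%:E + \int[P]_w (rp w ^+ 2)%:E +
      (\int[P]_w (rm w ^+ 2)%:E + \int[P]_w (rm w ^+ 2)%:E).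
    have intD (u v : W -> R) :
        measurable_fun [set: W] u -> measurable_fun [set: W] v ->
        (forall w, 0 <= u w)%R -> (forall w, 0 <= v w)%R ->
        \int[P]_w (u w)%:E + \int[P]_w (v w)%:E = \int[P]_w (u w + v w)%:E.
      move=> mu mv u0 v0; rewrite -ge0_integralD//.
      - by move=> w _; rewrite lee_fin.
      - exact/measurable_EFinP.
      - by move=> w _; rewrite lee_fin.
      - exact/measurable_EFinP.
    have m2 (r : W -> R) : measurable_fun [set: W] r ->
        measurable_fun [set: W] (fun w => r w ^+ 2)%R.
      by move=> mr; exact: measurable_funX.
    have q0 (r : W -> R) w : (0 <= r w ^+ 2)%R by exact: sqr_ge0.
    have mrpm : measurable_fun [set: W] (fun w => (rp w + rm w)%R).
      exact: measurable_funD.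
    rewrite (intD _ _ (m2 _ mV) (m2 _ mrpm) (q0 V) (q0 _)).
    rewrite (intD _ _ (m2 _ mrp) (m2 _ mrp) (q0 rp) (q0 rp)).
    rewrite (intD _ _ (m2 _ mrm) (m2 _ mrm) (q0 rm) (q0 rm)).
    rewrite intD; last 4 first.
    - by apply: measurable_funD; exact: m2.
    - by apply: measurable_funD; exact: m2.
    - by move=> w; rewrite addr_ge0.
    - by move=> w; rewrite addr_ge0.
    by apply: eq_integral => w _; congr EFin; rewrite /V; ring.
  (* The finiteness of E V^2 is read off here: an infinite value would contradict the finite
     right-hand side. *)
  rewrite rp2 rm2 ra2; case: (\int[P]_w (V w ^+ 2)%:E) => [r| |]//=.
  rewrite -!EFinD => -[E]; congr EFin.
  by apply: (addIr ((a + b) * (a + b) + (ip + im)))%R; rewrite E; ring.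
have V2oo : \int[P]_w (V w ^+ 2)%:E < +oo by rewrite V2 ltry.
have mFhat : measurable_fun [set: W] Fhat.
  by apply/measurable_EFinP; case/integrableP: iFhat.
have Fhat2 : \int[P]_w (Fhat w ^+ 2)%:E = \int[P]_w (V w ^+ 2)%:E.
  apply: ae_eq_integral => //; [exact: msqr|exact: msqr|].
  by apply: filterS FV => w + _ => ->.
have Fhat1 : \int[P]_w (Fhat w)%:E = \int[P]_w (V w)%:E.
  apply: ae_eq_integral => //; [exact/measurable_EFinP|exact/measurable_EFinP|].
  by apply: filterS FV => w + _ => ->.
have L2 : Fhat \in Lfun P 2%:E by apply: Lfun2P => //; rewrite Fhat2.
split=> //; rewrite varianceE// unlock.
rewrite [X in X - _]Fhat2 Fhat1 V1 V2 IE aE bE.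
by rewrite -EFinB; congr EFin; ring.
Qed.
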